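(* Let $F$ be a finitely generated free group. The rational subset problem is decidable for: (i) direct products $F\times A$ with $A$ a finitely generated abelian group; (ii) direct products $F\times M$ with $M$ a finitely generated commutative monoid; and (iii) direct products $F\times X^*$ with $X$ a finite set, where $X^*$ denotes the free monoid on $X$.
   Context: A finite automaton over a finitely generated monoid $N$ is a finite directed graph with edges labelled by elements of $N$, with a distinguished initial vertex and a set of distinguished terminal vertices; the subset it recognises is the set of all elements of $N$ labelling paths (labels multiplied along the path) from the initial vertex to some terminal vertex. A subset of $N$ is rational if it is recognised by some finite automaton over $N$. The rational subset problem for $N$ is decidable if there is an algorithm which, given a finite automaton over $N$ (edge labels given as words over a fixed finite monoid generating set) and an element $n\in N$ (given as a word over the generating set), decides whether $n$ lies in the subset recognised; this does not depend on the choice of finite generating set. *)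

(* Defs.v *)
From HB Require Import structures.
From mathcomp Require Import all_boot.
Set Implicit Arguments.
Unset Strict Implicit.
Unset Printing Implicit Defensive.

Import Algebra.
Local Open Scope group_scope.

(* The total recursive functions nat^k -> nat, as the least class closed under
   composition, primitive recursion and minimization of regular functions (the
   search always succeeds).  Decidability is stated with this class because,
   under classical axioms, a mere function into nat is not an algorithm. *)
Inductive recursive : forall k : nat, (k.-tuple nat -> nat) -> Prop :=
| recursive_zero : recursive (fun _ : 0.-tuple nat => 0)
| recursive_succ : recursive (fun t : 1.-tuple nat => (thead t).+1)
| recursive_proj k (i : 'I_k) : recursive (fun t : k.-tuple nat => tnth t i)
| recursive_comp k m (g : m.-tuple nat -> nat)
      (h : 'I_m -> k.-tuple nat -> nat) :
    recursive g -> (forall i, recursive (h i)) ->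
    recursive (fun t : k.-tuple nat => g [tuple h i t | i < m])
| recursive_primrec k (g : k.-tuple nat -> nat) (h : k.+2.-tuple nat -> nat) :
    recursive g -> recursive h ->
    recursive (fun t : k.+1.-tuple nat =>
      iteri (thead t) (fun n r => h [tuple of n :: r :: behead t])
            (g [tuple of behead t]))
| recursive_mu k (g : k.+1.-tuple nat -> nat) (f : k.-tuple nat -> nat) :
    recursive g ->
    (forall t, g [tuple of f t :: t] = 0
               /\ forall m, m < f t -> g [tuple of m :: t] <> 0) ->
    recursive f
| recursive_ext k (f g : k.-tuple nat -> nat) :
    f =1 g -> recursive f -> recursive g.

Record automaton (L : Type) := Automaton {
  nvert : nat;
  init : 'I_nvert;
  term : {set 'I_nvert};
  edges : seq ('I_nvert * L * 'I_nvert) }.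

Definition relabel (L L' : Type) (h : L -> L') (A : automaton L) :
    automaton L' :=
  Automaton (init A) (term A) [seq (e.1.1, h e.1.2, e.2) | e <- edges A].

Section Recognition.
Variables (N : monoidType) (A : automaton N).

Inductive path_label : 'I_(nvert A) -> N -> 'I_(nvert A) -> Prop :=
| path_label_nil p : path_label p 1 p
| path_label_cons (p q r : 'I_(nvert A)) (x y : N) :
    (p, x, q) \in edges A -> path_label q y r ->
    path_label p (x * y) r.

Definition recognises (x : N) : Prop :=
  exists2 q, q \in term A & path_label (init A) x q.

End Recognition.

Definition word_value (N : monoidType) k (s : 'I_k -> N) (w : seq 'I_k) : N :=
  \prod_(i <- w) s i.

Definition monoid_generators (N : monoidType) k (s : 'I_k -> N) : Prop :=
  forall x, exists w, x = word_value s w.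

Definition finitely_generated_monoid (N : monoidType) : Prop :=
  exists k (s : 'I_k -> N), monoid_generators s.

Definition finitely_generated_group (G : groupType) : Prop :=
  exists k (s : 'I_k -> G), forall x, exists w : seq ('I_k * bool),
    x = \prod_(a <- w) (if a.2 then (s a.1)^-1 else s a.1).

(* Goedel numbers, built on the effective bijection CodeSeq.code between
   seq nat and nat. *)
Definition word_code k (w : seq 'I_k) : nat :=
  CodeSeq.code [seq val i | i <- w].

Definition automaton_code k (A : automaton (seq 'I_k)) : nat :=
  CodeSeq.code
    [:: nvert A; val (init A);
        CodeSeq.code [seq val q | q <- enum (term A)];
        CodeSeq.code
          [seq CodeSeq.code [:: val e.1.1; word_code e.1.2; val e.2]
          | e <- edges A]].

Definition rational_subset_decider (N : monoidType) k (s : 'I_k -> N)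
    (f : 2.-tuple nat -> nat) : Prop :=
  forall (A : automaton (seq 'I_k)) (w : seq 'I_k),
    f [tuple automaton_code A; word_code w] <> 0
    <-> recognises (relabel (word_value s) A) (word_value s w).

(* Decidability does not depend on the finite generating set, hence the
   quantification over all of them. *)
Definition rational_subset_problem_decidable (N : monoidType) : Prop :=
  finitely_generated_monoid N /\
  forall k (s : 'I_k -> N), monoid_generators s ->
    exists2 f, recursive f & rational_subset_decider s f.

Definition free_basis (F : groupType) (X : Type) (x : X -> F) : Prop :=
  forall (G : groupType) (f : X -> G),
    exists phi : {multiplicative F -> G}, (forall i, phi (x i) = f i) /\
      forall psi : {multiplicative F -> G},
        (forall i, psi (x i) = f i) -> psi =1 phi.

Definition free_group (F : groupType) : Prop :=
  exists (X : Type) (x : X -> F), free_basis x.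

Definition free_monoid (X : Type) := seq X.

HB.instance Definition _ (X : choiceType) :=
  Choice.copy (free_monoid X) (seq X).
HB.instance Definition _ (X : choiceType) :=
  isMonoid.Build (free_monoid X) (@catA X) (@cat0s X) (@cats0 X).

(* Main.v *)
(**
Let [A] be an automaton over [F * M].  A path of [A] has the value of a word [w] exactly when
its [F]-labels, preceded by the inverse of those of [w], reduce freely to the empty word and
its [M]-labels have the value of [w] in [M].

The first condition says that the path is derived by a context-free grammar whose nonterminals
are pairs of states: a Dyck path from [p] to [q] is empty, or starts with an edge carrying no
free letter, or is bracketed by edges with inverse letters.

For the second condition, words of value [w] in [M] are described by vectors of integers.  If
[M] is commutative, generated by [k] elements, then the congruence defining [M] as a quotient
of [nat^k] is a slice in the sense of Eilenberg and Schuetzenberger, hence a semilinear set;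
so the condition says that, after adding some periods, the commutative image of the path
is a prescribed vector.  If [M] is a free monoid, it suffices to keep track of the position
reached in [w].

A derivation of the grammar is determined, up to the order of the steps, by the multiset of its
rules, and the multisets arising so are those which are balanced and connected (an analogue of
Euler's theorem on closed trails).  Keep one copy of each rule used; the others form a multiset
of integer vectors with prescribed sum, and a multiset of vectors with zero sum decomposes into
submultisets with zero sum whose size is bounded by an explicit function of the dimension and
the entries.  Hence a derivation of minimal size has a size bounded by a recursive function of
the input, and it suffices to test the finitely many paths within that bound.
*)
Require Import Defs.
From HB Require Import structures.
From mathcomp Require Import all_boot all_order all_algebra zify.
From Stdlib Require Import ClassicalEpsilon.
Set Implicit Arguments.
Unset Strict Implicit.
Unset Printing Implicit Defensive.
Import Order.TTheory GRing.Theory Num.Theory.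

(** * Recursive functions on environments *)

Definition env_tuple k (e : seq nat) : k.-tuple nat := [tuple nth 0 e i | i < k].

(** Environments are lists read with default 0, so that functions of all arities live on one type;
    only finitely many entries may matter. *)
Definition rec (f : seq nat -> nat) : Prop :=
  exists k (g : k.-tuple nat -> nat),
    recursive g /\ forall e, f e = g (env_tuple k e).

Lemma rec_ext f g : f =1 g -> rec f -> rec g.
Proof. by move=> fg [k [h [rh fh]]]; exists k, h; split=> // e; rewrite -fg. Qed.

Lemma rec_widen f : rec f -> exists k, forall m, k <= m ->
  exists g : m.-tuple nat -> nat, recursive g /\ forall e, f e = g (env_tuple m e).
Proof.
case=> k [g [rg fg]]; exists k => m km.
exists (fun t => g [tuple tnth t (widen_ord km i) | i < k]); split.
  by apply: recursive_comp rg _ => i; apply: recursive_proj.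
move=> e; rewrite fg; congr g; apply: eq_from_tnth => i.
by rewrite !tnth_mktuple.
Qed.

Lemma rec_var i : rec (fun e => nth 0 e i).
Proof.
exists i.+1, (fun t => tnth t ord_max); split; first exact: recursive_proj.
by move=> e; rewrite tnth_mktuple.
Qed.

Lemma rec_family m (f : 'I_m -> seq nat -> nat) : (forall i, rec (f i)) ->
  exists k (g : 'I_m -> k.-tuple nat -> nat),
    forall i, recursive (g i) /\ forall e, f i e = g i (env_tuple k e).
Proof.
move=> rf; have [K HK] := choice _ (fun i => rec_widen (rf i)).
exists (\max_i K i).
have /choice[g Hg] i := HK i _ (leq_bigmax i).
by exists g.
Qed.

Lemma rec_comp m (g : m.-tuple nat -> nat) (f : 'I_m -> seq nat -> nat) :
  recursive g -> (forall i, rec (f i)) ->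
  rec (fun e => g [tuple f i e | i < m]).
Proof.
move=> rg /rec_family[k [h Hh]].
exists k, (fun t => g [tuple h i t | i < m]); split.
  by apply: recursive_comp rg _ => i; case: (Hh i).
move=> e; congr g; apply: eq_from_tnth => i; rewrite !tnth_mktuple.
by case: (Hh i).
Qed.

Lemma rec_env f (r : seq nat -> seq nat) :
  rec f -> (forall i, rec (fun e => nth 0 (r e) i)) -> rec (fun e => f (r e)).
Proof.
case=> k [g [rg fg]] rr.
apply: rec_ext (rec_comp rg (fun i : 'I_k => rr i)) => e.
by rewrite fg.
Qed.

Lemma rec_succ f : rec f -> rec (fun e => (f e).+1).
Proof.
move=> rf; apply: rec_ext (rec_comp (f := fun=> f) recursive_succ _) => // e.
by rewrite -[thead _]/(tnth _ ord0) tnth_mktuple.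
Qed.

Lemma rec_const n : rec (fun=> n).
Proof.
elim: n => [|n]; last exact: rec_succ.
by exists 0, (fun=> 0); split=> //; apply: recursive_zero.
Qed.

Lemma env_tuple_cons k a e :
  [tuple of a :: env_tuple k e] = env_tuple k.+1 (a :: e).
Proof.
apply: eq_from_tnth => i; rewrite tnth_mktuple.
case: (unliftP ord0 i) => [j ->|->]; last by [].
by rewrite tnthS tnth_mktuple.
Qed.

Lemma env_tuple_tuple k (t : k.-tuple nat) : env_tuple k t = t.
Proof. by apply: eq_from_tnth => i; rewrite tnth_mktuple -tnth_nth. Qed.

Lemma rec_cons f a : rec f -> rec a -> rec (fun e => f (a e :: e)).
Proof. by move=> rf ra; apply: rec_env rf _ => -[|i] //=; apply: rec_var. Qed.

Lemma rec_iteri N g h : rec N -> rec g -> rec h ->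
  rec (fun e => iteri (N e) (fun n r => h (n :: r :: e)) (g e)).
Proof.
move=> rN /rec_widen[k1 H1] /rec_widen[k2 H2].
have [g' [rg gE]] := H1 _ (leq_maxl k1 k2).
have [h' [rh hE]] := H2 _ (leqW (leqW (leq_maxr k1 k2))).
set k := maxn k1 k2 in g' rg gE h' rh hE.
(* [recursive_primrec] takes the number of rounds from its first argument, so this is first done for
   the head of the environment; [N e] is pushed there afterwards. *)
have rF : rec (fun e => iteri (nth 0 e 0) (fun n r => h (n :: r :: behead e))
                          (g (behead e))).
  exists k.+1; eexists; split; first exact: recursive_primrec rg rh.
  move=> e /=; rewrite -[thead _]/(tnth _ ord0) tnth_mktuple.
  have tE : env_tuple k (behead e) =
      behead [seq nth 0 e (val i) | i <- enum 'I_k.+1] :> seq nat.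
    by rewrite enum_ordSl /= -map_comp; apply: eq_map => i /=; rewrite nth_behead.
  elim: (nth 0 e ord0) => /= [|n ->].
    by rewrite gE; congr g'; apply: val_inj.
  by rewrite hE -!env_tuple_cons; congr h'; apply: val_inj; congr [:: _, _ & _].
exact: rec_ext (rec_cons rF rN).
Qed.

Definition rec1 (f : nat -> nat) := rec (fun e => f (nth 0 e 0)).
Definition rec2 (f : nat -> nat -> nat) :=
  rec (fun e => f (nth 0 e 0) (nth 0 e 1)).
Definition rec3 (f : nat -> nat -> nat -> nat) :=
  rec (fun e => f (nth 0 e 0) (nth 0 e 1) (nth 0 e 2)).

Lemma rec_app1 f a : rec1 f -> rec a -> rec (fun e => f (a e)).
Proof.
move=> rf ra; apply: (rec_env (r := fun e => [:: a e])) rf _ => -[|i] //=.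
by rewrite nth_nil; apply: rec_const.
Qed.

Lemma rec_app2 f a b : rec2 f -> rec a -> rec b -> rec (fun e => f (a e) (b e)).
Proof.
move=> rf ra rb; apply: (rec_env (r := fun e => [:: a e; b e])) rf _ => -[|[|i]] //=.
by rewrite nth_nil; apply: rec_const.
Qed.

Lemma rec_app3 f a b c : rec3 f -> rec a -> rec b -> rec c ->
  rec (fun e => f (a e) (b e) (c e)).
Proof.
move=> rf ra rb rc.
apply: (rec_env (r := fun e => [:: a e; b e; c e])) rf _ => -[|[|[|i]]] //=.
by rewrite nth_nil; apply: rec_const.
Qed.

Lemma rec1_pred : rec1 predn.
Proof.
apply: rec_ext (rec_iteri (rec_var 0) (rec_const 0) (rec_var 0)) => e.
by case: (nth 0 e 0).
Qed.

Lemma rec2_add : rec2 addn.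
Proof.
apply: rec_ext (rec_iteri (rec_var 0) (rec_var 1) (rec_succ (rec_var 1))) => e.
by elim: (nth 0 e 0) => //= n ->.
Qed.

Lemma rec2_sub : rec2 subn.
Proof.
apply: rec_ext (rec_iteri (rec_var 1) (rec_var 0) (rec_app1 rec1_pred (rec_var 1))) => e.
by elim: (nth 0 e 1) => /= [|n ->]; rewrite ?subn0 ?subnS.
Qed.

Lemma rec2_mul : rec2 muln.
Proof.
apply: rec_ext (rec_iteri (rec_var 0) (rec_const 0)
  (rec_app2 rec2_add (rec_var 3) (rec_var 1))) => e.
by elim: (nth 0 e 0) => //= n ->; rewrite mulSn.
Qed.

Lemma rec2_exp : rec2 expn.
Proof.
apply: rec_ext (rec_iteri (rec_var 1) (rec_const 1)
  (rec_app2 rec2_mul (rec_var 2) (rec_var 1))) => e.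
by elim: (nth 0 e 1) => //= n ->; rewrite expnS.
Qed.

(** * Recursive predicates, bounded search and minimization *)

Definition recb (p : seq nat -> bool) := rec (fun e => p e : nat).

Lemma recb_ext p q : p =1 q -> recb p -> recb q.
Proof. by move=> pq; apply: rec_ext => e; rewrite pq. Qed.

Lemma recb_neg p : recb p -> recb (fun e => ~~ p e).
Proof.
by move/(rec_app2 rec2_sub (rec_const 1)); apply: rec_ext => e /=; case: (p e).
Qed.

Lemma recb_and p q : recb p -> recb q -> recb (fun e => p e && q e).
Proof.
by move=> rp /(rec_app2 rec2_mul rp); apply: rec_ext => e /=; rewrite mulnb.
Qed.

Lemma recb_or p q : recb p -> recb q -> recb (fun e => p e || q e).
Proof.
move=> /recb_neg rp /recb_neg rq; apply: recb_ext (recb_neg (recb_and rp rq)) => e.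
by rewrite negb_and !negbK.
Qed.

Lemma recb_leq a b : rec a -> rec b -> recb (fun e => a e <= b e).
Proof.
move=> ra rb.
have := rec_app2 rec2_sub (rec_const 1) (rec_app2 rec2_sub ra rb).
by apply: rec_ext => e; rewrite -subn_eq0; case: (a e - b e).
Qed.

Lemma recb_eq a b : rec a -> rec b -> recb (fun e => a e == b e).
Proof.
move=> ra rb; apply: recb_ext (recb_and (recb_leq ra rb) (recb_leq rb ra)) => e.
by rewrite eqn_leq.
Qed.

Lemma recb_ltn a b : rec a -> rec b -> recb (fun e => a e < b e).
Proof. by move=> ra; apply: recb_leq; apply: rec_succ. Qed.

Lemma rec_if p a b : recb p -> rec a -> rec b ->
  rec (fun e => if p e then a e else b e).
Proof.
move=> rp ra rb.
have := rec_app2 rec2_add (rec_app2 rec2_mul rp ra)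
  (rec_app2 rec2_mul (recb_neg rp) rb).
by apply: rec_ext => e /=; case: (p e); rewrite ?mul1n ?mul0n ?addn0.
Qed.

Lemma recb_has N p : rec N -> recb p ->
  recb (fun e => has (fun n => p (n :: e)) (iota 0 (N e))).
Proof.
move=> rN rp.
(* During the iteration the environment is index, accumulator, [e]; the accumulator has to be
   dropped for [p]. *)
have rq : recb (fun e => p (nth 0 e 0 :: behead (behead e))).
  apply: (rec_env (r := fun e => nth 0 e 0 :: behead (behead e))) rp _ => -[|i].
    exact: rec_var.
  by apply: rec_ext (rec_var i.+2) => e /=; rewrite !nth_behead.
have rr : recb (fun e => p (nth 0 e 0 :: behead (behead e)) || (0 < nth 0 e 1)).
  by apply: recb_or => //; apply: recb_ltn (rec_const 0) (rec_var 1).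
apply: rec_ext (rec_iteri rN (rec_const 0) rr) => e /=.
elim: (N e) => // n IH; rewrite -[in RHS]addn1 iotaD has_cat [LHS]/= IH /= add0n.
by rewrite orbF orbC; case: has.
Qed.

Lemma rec_mu (f : seq nat -> nat) (p : seq nat -> bool) :
  recb p -> (forall e, p (f e :: e)) ->
  (forall e m, m < f e -> ~~ p (m :: e)) -> rec f.
Proof.
move=> /recb_neg/rec_widen[k0 Hk] fP fmin.
have [g [rg pg]] := Hk k0.+1 (leqnSn _).
(* The least solution depends only on the entries that [p] looks at, so [f] is a function of tuples
   of fixed length. *)
have fE e : f e = f (env_tuple k0 e).
  have pE m : p (m :: e) = p (m :: env_tuple k0 e).
    apply: negb_inj; have := pg (m :: e); have := pg (m :: env_tuple k0 e).
    rewrite -[env_tuple k0.+1 (m :: e)]env_tuple_cons.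
    rewrite -[env_tuple k0.+1 (m :: env_tuple k0 e)]env_tuple_cons.
    rewrite env_tuple_tuple => <-.
    by case: (p (m :: e)); case: (p _).
  case: (ltngtP (f e) (f (env_tuple k0 e))) => // /fmin.
    by rewrite -pE fP.
  by rewrite pE fP.
exists k0, (fun t => f t); split=> //.
apply: (recursive_mu rg) => t; split.
  have := pg (f t :: t); rewrite fP.
  by rewrite -[env_tuple _ _]env_tuple_cons env_tuple_tuple.
move=> m /fmin; have := pg (m :: t).
by rewrite -[env_tuple _ _]env_tuple_cons env_tuple_tuple => <-; case: (p _).
Qed.

(** * Recursive functions on coded lists *)

Definition recl (l : seq nat -> seq nat) := rec (fun e => CodeSeq.code (l e)).

Lemma recl_ext l l' : l =1 l' -> recl l -> recl l'.
Proof. by move=> ll'; apply: rec_ext => e; rewrite ll'. Qed.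

Lemma recl_decode a : rec a -> recl (fun e => CodeSeq.decode (a e)).
Proof. by apply: rec_ext => e; rewrite CodeSeq.decodeK. Qed.

Lemma recl_nil : recl (fun=> [::]).
Proof. exact: rec_const. Qed.

Lemma recl_cons a l : rec a -> recl l -> recl (fun e => a e :: l e).
Proof.
move=> ra rl; have := rec_app2 rec2_mul (rec_app2 rec2_exp (rec_const 2) ra)
  (rec_succ (rec_app2 rec2_mul (rec_const 2) rl)).
by apply: rec_ext => e /=; rewrite mul2n.
Qed.

Definition is_cons_code c i q := c == CodeSeq.code (i :: CodeSeq.decode q).

Lemma is_cons_codeP c i q : reflect (CodeSeq.decode c = i :: CodeSeq.decode q)
  (is_cons_code c i q).
Proof.
by apply: (iffP eqP) => [->|E]; rewrite ?CodeSeq.codeK // -E CodeSeq.decodeK.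
Qed.

Lemma recb_is_cons_code c i q : rec c -> rec i -> rec q ->
  recb (fun e => is_cons_code (c e) (i e) (q e)).
Proof.
by move=> rc ri rq; apply: recb_eq rc (recl_cons ri (recl_decode rq)).
Qed.

(** The code of [i :: s] is [2 ^ i * (2 * code s + 1)]. These inequalities bound the inner searches
    when head and tail are computed by minimization. *)
Lemma decode_eq_cons c i s : CodeSeq.decode c = i :: s ->
  i < c /\ CodeSeq.code s < c.
Proof.
move=> E; rewrite -[c]CodeSeq.decodeK E.
have /= /andP[-> _] := CodeSeq.ltn_code (i :: s); split=> //=.
by apply: leq_trans (leq_pmull _ _); rewrite ?expn_gt0 // ltnS -addnn leq_addr.
Qed.

Lemma decode_eq_nil c : CodeSeq.decode c = [::] -> c = 0.
Proof. by move=> E; rewrite -[c]CodeSeq.decodeK E. Qed.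

Lemma rec1_head : rec1 (fun c => head 0 (CodeSeq.decode c)).
Proof.
(* On the code 0 of the empty list the search has to stop at 0, the default of [head]. *)
set p := fun e => (nth 0 e 1 == 0) ||
  has (fun q => is_cons_code (nth 0 e 1) (nth 0 e 0) q) (iota 0 (nth 0 e 1)).
have rp : recb p.
  apply: recb_or; first exact: recb_eq (rec_var 1) (rec_const 0).
  by apply: (@recb_has _ (fun e => is_cons_code (nth 0 e 2) (nth 0 e 1) (nth 0 e 0)));
    [exact: rec_var | apply: recb_is_cons_code; apply: rec_var].
apply: (rec_mu rp) => [e|e m]; rewrite /p /=; set c := nth 0 e 0.
  case E: (CodeSeq.decode c) => [|i s]; first by rewrite (decode_eq_nil E).
  apply/orP; right; apply/hasP; exists (CodeSeq.code s).
    by rewrite mem_iota; case: (decode_eq_cons E).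
  by apply/is_cons_codeP; rewrite CodeSeq.codeK.
case: eqP => [->|_] //=.
by move=> mh; apply/hasPn => q _; apply/is_cons_codeP => E; rewrite E ltnn in mh.
Qed.

Lemma rec1_behead : recl (fun e => behead (CodeSeq.decode (nth 0 e 0))).
Proof.
set p := fun e => (nth 0 e 1 == 0) && (nth 0 e 0 == 0) ||
  has (fun i => is_cons_code (nth 0 e 1) i (nth 0 e 0)) (iota 0 (nth 0 e 1)).
have rp : recb p.
  apply: recb_or.
    by apply: recb_and; apply: recb_eq (rec_const 0); apply: rec_var.
  by apply: (@recb_has _ (fun e => is_cons_code (nth 0 e 2) (nth 0 e 0) (nth 0 e 1)));
    [exact: rec_var | apply: recb_is_cons_code; apply: rec_var].
apply: (rec_mu rp) => [e|e m]; rewrite /p /=; set c := nth 0 e 0.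
  case E: (CodeSeq.decode c) => [|i s]; first by rewrite (decode_eq_nil E).
  apply/orP; right; apply/hasP; exists i.
    by rewrite mem_iota; case: (decode_eq_cons E).
  by apply/is_cons_codeP; rewrite CodeSeq.codeK.
case: eqP => [->|_] //=.
by move=> mh; apply/hasPn => i _; apply/is_cons_codeP => E;
  rewrite E /= CodeSeq.decodeK ltnn in mh.
Qed.

Lemma rec_head l : recl l -> rec (fun e => head 0 (l e)).
Proof. by move/(rec_app1 rec1_head); apply: rec_ext => e; rewrite CodeSeq.codeK. Qed.

Lemma recl_behead l : recl l -> recl (fun e => behead (l e)).
Proof.
move/(rec_app1 (f := fun c => CodeSeq.code (behead (CodeSeq.decode c))) rec1_behead).
by apply: rec_ext => e; rewrite CodeSeq.codeK.
Qed.

Lemma recl_drop n l : rec n -> recl l -> recl (fun e => drop (n e) (l e)).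
Proof.
move=> rn rl.
apply: rec_ext (rec_iteri rn rl (recl_behead (recl_decode (rec_var 1)))) => e /=.
elim: (n e) => /= [|m ->]; first by rewrite drop0.
by rewrite CodeSeq.codeK -drop1 drop_drop add1n.
Qed.

Lemma rec_nth l n : recl l -> rec n -> rec (fun e => nth 0 (l e) (n e)).
Proof.
by move=> rl rn; apply: rec_ext (rec_head (recl_drop rn rl)) => e; rewrite -nth0 nth_drop addn0.
Qed.

Lemma rec_size l : recl l -> rec (fun e => size (l e)).
Proof.
move=> rl.
have r1 : rec (fun e => size (CodeSeq.decode (nth 0 e 0))).
  have rp := recb_eq (recl_drop (rec_var 0) (recl_decode (rec_var 1))) (rec_const 0).
  apply: (rec_mu rp) => [e|e m] /=; first by rewrite drop_size.
  set s := CodeSeq.decode _ => ms; apply/eqP => /(congr1 CodeSeq.decode).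
  by rewrite CodeSeq.codeK => /(congr1 size)/eqP; rewrite size_drop subn_eq0 leqNgt ms.
apply: rec_ext (rec_app1 (f := fun c => size (CodeSeq.decode c)) r1 rl) => e.
by rewrite CodeSeq.codeK.
Qed.

(** Primitive recursion counts upwards whereas [foldr] starts with the last entry, so round [i]
    reads the list from its end. *)
Lemma foldr_iteri T (x0 : T) R (h : T -> R -> R) z s :
  foldr h z s = iteri (size s) (fun i r => h (nth x0 s (size s - i.+1)) r) z.
Proof.
suff H n : n <= size s -> iteri n (fun i r => h (nth x0 s (size s - i.+1)) r) z =
    foldr h z (drop (size s - n) s).
  by rewrite H // subnn drop0.
elim: n => [|n IH] ns; first by rewrite subn0 drop_size.
rewrite /= IH 1?ltnW // [in RHS](drop_nth x0) ?ltn_subrL ?(leq_trans _ ns) //=.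
by rewrite -subSn // subSS.
Qed.

(* The parameter [p] carries the data the step function needs, coded in one number. *)
Lemma rec_iteri3 N h z p : rec N -> rec3 h -> rec z -> rec p ->
  rec (fun e => iteri (N e) (fun n r => h n r (p e)) (z e)).
Proof.
move=> rN rh rz rp.
apply: (rec_app3 (f := fun m q w => iteri m (fun n r => h n r q) w)) rN rp rz.
apply: (rec_iteri (h := fun e => h (nth 0 e 0) (nth 0 e 1) (nth 0 e 3)) (rec_var 0) (rec_var 2)).
exact: rec_app3 rh (rec_var 0) (rec_var 1) (rec_var 3).
Qed.

Lemma rec_foldr h z l p : rec3 h -> rec z -> recl l -> rec p ->
  rec (fun e => foldr (fun a r => h a r (p e)) (z e) (l e)).
Proof.
move=> rh rz rl rp.
(* The list and the parameter are packed into one number, as [rec_iteri3] passes on only one. *)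
pose L q := CodeSeq.decode (nth 0 (CodeSeq.decode q) 0).
pose h' n r q := h (nth 0 (L q) (size (L q) - n.+1)) r (nth 0 (CodeSeq.decode q) 1).
have rL : recl (fun e => L (nth 0 e 2)).
  exact: recl_decode (rec_nth (recl_decode (rec_var 2)) (rec_const 0)).
have rh' : rec3 h'.
  apply: rec_app3 rh _ (rec_var 1) (rec_nth (recl_decode (rec_var 2)) (rec_const 1)).
  exact: rec_nth rL (rec_app2 rec2_sub (rec_size rL) (rec_succ (rec_var 0))).
apply: rec_ext (rec_iteri3 (rec_size rl) rh' rz
  (recl_cons rl (recl_cons rp recl_nil))) => e.
rewrite (foldr_iteri 0); apply: eq_iteri => n r.
by rewrite /h' /L !CodeSeq.codeK.
Qed.

Lemma recl_foldr (h : nat -> seq nat -> nat -> seq nat) z l p :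
  recl (fun e => h (nth 0 e 0) (CodeSeq.decode (nth 0 e 1)) (nth 0 e 2)) ->
  recl z -> recl l -> rec p ->
  recl (fun e => foldr (fun a r => h a r (p e)) (z e) (l e)).
Proof.
move=> rh rz rl rp.
have := rec_foldr (h := fun a r q => CodeSeq.code (h a (CodeSeq.decode r) q)) rh rz rl rp.
apply: rec_ext => e; elim: (l e) => //= a s ->.
by rewrite CodeSeq.codeK.
Qed.

Lemma recl_cat l l' : recl l -> recl l' -> recl (fun e => l e ++ l' e).
Proof.
move=> rl rl'; apply: recl_ext (recl_foldr (h := fun a r _ => a :: r) _ rl' rl (rec_const 0)).
  by move=> e; elim: (l e) => //= a s ->.
exact: recl_cons (rec_var 0) (recl_decode (rec_var 1)).
Qed.

(** A finite table is recursive whatever its origin; this admits data on the generators that were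
    obtained by choice. *)
Lemma rec_finite_support f : (exists n, forall m, n <= m -> f m = 0) -> rec1 f.
Proof.
case=> n fn.
apply: rec_ext (rec_nth (l := fun=> mkseq f n) (rec_const _) (rec_var 0)) => e.
have [mn|nm] := ltnP (nth 0 e 0) n; first by rewrite nth_mkseq.
by rewrite fn // nth_default // size_mkseq.
Qed.

Lemma recl_flatten_map (f : nat -> seq nat) l :
  (exists n, forall m, n <= m -> f m = [::]) -> recl l ->
  recl (fun e => flatten [seq f a | a <- l e]).
Proof.
move=> [n fn] rl.
apply: recl_ext (recl_foldr (h := fun a r _ => f a ++ r) _ recl_nil rl (rec_const 0)).
  by move=> e; elim: (l e) => //= a s ->.
apply: recl_cat (recl_decode (rec_var 1)).
have : rec1 (fun a => CodeSeq.code (f a)).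
  by apply: rec_finite_support; exists n => m /fn ->.
by [].
Qed.

Lemma rec_count a l : rec a -> recl l -> rec (fun e => count_mem (a e) (l e)).
Proof.
move=> ra rl.
apply: rec_ext (rec_foldr (h := fun b r c => (b == c) + r) _ (rec_const 0) rl ra).
  by move=> e; elim: (l e) => //= b s ->.
exact: rec_app2 rec2_add (recb_eq (rec_var 0) (rec_var 2)) (rec_var 1).
Qed.

Lemma recb_eql l l' : recl l -> recl l' -> recb (fun e => l e == l' e).
Proof.
move=> rl rl'; apply: recb_ext (recb_eq rl rl') => e.
exact: (inj_eq (can_inj CodeSeq.codeK)).
Qed.

(** * Multisets of integer vectors with zero sum *)

Import Order.TTheory GRing.Theory Num.Theory.

Definition bounded (K : nat) (x : int) := (`|x| <= K%:Z)%R.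

Lemma sum_ge0_exists (X : eqType) (g : X -> int) s :
  s != [::] -> (0 <= \sum_(x <- s) g x)%R -> exists2 x, x \in s & (0 <= g x)%R.
Proof.
move=> s0 sum0; apply/hasP/negPn/negP => /hasPn H.
suff: (\sum_(x <- s) g x < 0)%R by rewrite ltNge sum0.
elim: s s0 H {sum0} => // a s IH _ H; rewrite big_cons.
have /= := H a (mem_head _ _).
have [->|s0] := eqVneq s [::]; first by rewrite big_nil; lia.
have: (\sum_(x <- s) g x < 0)%R; last by move: (\sum_(x <- s) g x)%R => S; lia.
by apply: IH => // x xs; apply: H; rewrite inE xs orbT.
Qed.

(** The next element is chosen with a sign that does not push the current partial sum further away
    from zero; it exists because the total is zero. *)
Lemma bounded_ordering (X : eqType) (g : X -> int) K s (t : int) :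
  (forall x, x \in s -> bounded K (g x)) -> bounded K t ->
  (t + \sum_(x <- s) g x = 0)%R ->
  exists2 s', perm_eq s s' &
    forall i, bounded K (t + \sum_(x <- take i s') g x)%R.
Proof.
have [n] := ubnP (size s); elim: n s t => // n IH s t sn Hs Ht E.
have [s0|s0] := eqVneq s [::].
  by exists [::]; rewrite ?s0 // => i; rewrite big_nil addr0.
have [x xs /andP[xt tx]]: exists2 x, x \in s & bounded K (t + g x)%R && true.
  have [t0|t0] := lerP t 0%R.
    have [|x xs gx] := @sum_ge0_exists X g s s0; first by lia.
    by exists x; rewrite // andbT; have := Hs x xs; move: Ht; rewrite /bounded; lia.
  have [|x xs gx] := @sum_ge0_exists X (fun x => - g x)%R s s0.
    by rewrite sumrN; move: E; move: (\sum_(x <- s) g x)%R => S; lia.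
  by exists x; rewrite // andbT; have := Hs x xs; move: Ht; rewrite /bounded; lia.
have ps := perm_to_rem xs.
have [|||s' pss' Hs'] := IH (rem x s) (t + g x)%R _ _ xt.
- by rewrite size_rem //; move: s0 sn; case: (s).
- by move=> y /mem_rem; apply: Hs.
- by move: E; rewrite (perm_big _ ps) /= big_cons addrA.
exists (x :: s'); first by rewrite (perm_trans ps) // perm_cons.
case=> [|i]; first by rewrite take0 big_nil addr0.
by rewrite /= big_cons addrA.
Qed.

(** In the ordering above the partial sums take at most [2 K + 1] values, so two of the first
    [2 K + 2] agree, and the segment between them is a block with zero sum that can be split off. *)
Lemma zero_sum_blocks1 (X : eqType) (g : X -> int) K s :
  (forall x, x \in s -> bounded K (g x)) -> (\sum_(x <- s) g x = 0)%R ->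
  exists2 ss, perm_eq s (flatten ss) &
    forall b, b \in ss -> size b <= K.*2.+1 /\ (\sum_(x <- b) g x = 0)%R.
Proof.
have [n] := ubnP (size s); elim: n s => // n IH s sn Hs E.
have [sK|Ks] := leqP (size s) K.*2.+1.
  by exists [:: s]; rewrite /= ?cats0 // => b; rewrite inE => /eqP->.
have [||s' pss' Hs'] := @bounded_ordering X g K s 0%R Hs; rewrite ?add0r //.
pose P (i : nat) := (\sum_(x <- take i s') g x)%R.
have HP i : bounded K (P i) by have := Hs' i; rewrite add0r.
pose f (i : 'I_K.*2.+2) : 'I_K.*2.+1 := inord (absz (P i + K%:Z)%R).
have [i [j [ij Pij]]] : exists i j : nat, i < j <= K.*2.+1 /\ P i = P j.
  have /injectivePn[i [j ij fij]] : ~~ injectiveb f.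
    by apply/negP => /injectiveP/leq_card; rewrite !card_ord ltnn.
  have Pij : P i = P j.
    have /(congr1 (@nat_of_ord _)) := fij; rewrite /f; move: (HP i) (HP j); rewrite /bounded.
    by move: (P i) (P j) => a b Ha Hb; rewrite !inordK; lia.
  have := ltn_ord i; have := ltn_ord j.
  have : (i : nat) != j by []; move: Pij; clear.
  case: (ltngtP i j) => // h Pij _ Hj Hi; first by exists i, j; split=> //; rewrite h.
  by exists j, i; split=> //; rewrite h.
case/andP: ij => ij jK.
pose b := drop i (take j s').
have tE : take j s' = take i s' ++ b.
  by rewrite /b -[in LHS](cat_take_drop i (take j s')) take_takel // ltnW.
have bE : (\sum_(x <- b) g x = 0)%R.
  have : P j = (P i + \sum_(x <- b) g x)%R by rewrite /P tE big_cat.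
  by rewrite Pij; move: (P j) (\sum_(x <- b) g x)%R => u v; lia.
have js : j < size s' by rewrite -(perm_size pss'); lia.
have sb : size b = j - i by rewrite size_drop size_takel // ltnW.
have ps : perm_eq s (b ++ (take i s' ++ drop j s')).
  rewrite (perm_trans pss') // -{1}(cat_take_drop j s') tE -catA perm_sym.
  by rewrite perm_catCA.
have [|||ss pss Hss] := IH (take i s' ++ drop j s').
- by move: (perm_size ps) ij sb; rewrite size_cat; lia.
- by move=> x xs; apply: Hs; rewrite (perm_mem ps) mem_cat xs orbT.
- by move: E; rewrite (perm_big _ ps) /= big_cat /= bE add0r.
exists (b :: ss); first by rewrite (perm_trans ps) //= perm_cat2l.
move=> c; rewrite inE => /orP[/eqP->|]; last exact: Hss.
by split=> //; rewrite sb; lia.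
Qed.

(** One more coordinate: the blocks for the earlier ones have sums of absolute value at most
    [K = C * block_bound C D'] in the new one, and at most [2 K + 1] of them are merged. *)
Fixpoint block_bound (C D : nat) : nat :=
  if D is D'.+1 then block_bound C D' * (C * block_bound C D').*2.+1 else 1.

Lemma bounded_sum (X : eqType) (g : X -> int) C s :
  (forall x, x \in s -> bounded C (g x)) ->
  bounded (C * size s) (\sum_(x <- s) g x)%R.
Proof.
elim: s => [|a s IH] H; first by rewrite big_nil /bounded normr0.
have := H a (mem_head _ _); have : bounded (C * size s) (\sum_(x <- s) g x)%R.
  by apply: IH => x xs; apply: H; rewrite inE xs orbT.
by rewrite big_cons /bounded /=; lia.
Qed.

Lemma bounded_leq K K' x : K <= K' -> bounded K x -> bounded K' x.
Proof. by rewrite /bounded; lia. Qed.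

Lemma big_flatten_seq (X : eqType) (g : X -> int) ss :
  (\sum_(x <- flatten ss) g x = \sum_(b <- ss) \sum_(x <- b) g x)%R.
Proof. by elim: ss => [|b ss IH]; rewrite ?big_nil //= big_cat big_cons IH. Qed.

Lemma size_flatten_leq (X : eqType) (ss : seq (seq X)) m :
  (forall b, b \in ss -> size b <= m) -> size (flatten ss) <= m * size ss.
Proof.
elim: ss => [|b ss IH] H //=; rewrite size_cat mulnS leq_add ?H ?mem_head //.
by apply: IH => c cs; apply: H; rewrite inE cs orbT.
Qed.

(** Induction on the dimension; the blocks found so far are the elements to which the
    one-dimensional case is applied. *)
Lemma zero_sum_blocks (X : eqType) (f : nat -> X -> int) C D s :
  (forall i x, i < D -> x \in s -> bounded C (f i x)) ->
  (forall i, i < D -> (\sum_(x <- s) f i x = 0)%R) ->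
  exists2 ss, perm_eq s (flatten ss) &
    forall b, b \in ss -> size b <= block_bound C D /\
      forall i, i < D -> (\sum_(x <- b) f i x = 0)%R.
Proof.
elim: D => [|D IH] Hb Hs.
  exists [seq [:: x] | x <- s]; first by rewrite flatten_seq1.
  by move=> b /mapP[x _ ->].
have [i x iD|i iD|ss pss Hss] := IH; [by apply/Hb/ltnW|by apply/Hs/ltnW|].
pose g (b : seq X) := (\sum_(x <- b) f D x)%R.
have [b bss||tt ptt Htt] := @zero_sum_blocks1 _ g (C * block_bound C D) ss.
- have [bL _] := Hss b bss.
  apply: bounded_leq (bounded_sum (C := C) _); first by rewrite leq_mul2l bL orbT.
  move=> x xb; apply: Hb => //; rewrite (perm_mem pss); apply/flattenP.
  by exists b.
- by rewrite -big_flatten_seq -(perm_big _ pss) Hs.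
exists [seq flatten t | t <- tt].
  rewrite (perm_trans pss) //.
  apply: perm_trans (_ : perm_eq (flatten (flatten tt)) _).
    exact: perm_flatten.
  elim: (tt) => //= t tt' IHt; rewrite flatten_cat perm_cat2l //.
move=> _ /mapP[t tin ->]; have [tK tz] := Htt t tin.
have sub b : b \in t -> b \in ss.
  by move=> bt; rewrite (perm_mem ptt); apply/flattenP; exists t.
split.
  apply: leq_trans (size_flatten_leq (m := block_bound C D) _) _.
    by move=> b /sub/Hss[].
  by rewrite /= leq_mul2l tK orbT.
move=> i; rewrite ltnS leq_eqVlt => /orP[/eqP->|iD].
  by rewrite big_flatten_seq.
rewrite big_flatten_seq big1_seq // => b /andP[_ /sub/Hss[_]]; exact.
Qed.

(** * Commutative derivations *)

Section Derivation.
Variables (N R : eqType) (lhs : R -> N) (rhs : R -> seq N).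
Implicit Types (L : seq R) (C : seq N).

Definition heads L := [seq lhs r | r <- L].
Definition products L := flatten [seq rhs r | r <- L].

(** Forms are multisets and each listed rule fires exactly once: the multiset of rules is recorded,
    not their order. *)
Inductive derives : seq R -> seq N -> Prop :=
| derives_nil : derives [::] [::]
| derives_step L C r L' C' :
    perm_eq L (r :: L') -> perm_eq C (lhs r :: C') ->
    derives L' (rhs r ++ C') -> derives L C.

Lemma derives_perm L C L' C' :
  derives L C -> perm_eq L L' -> perm_eq C C' -> derives L' C'.
Proof.
move=> D; case: D L' C' => [|L1 C1 r L2 C2 pL pC D] L' C' pL' pC'.
  rewrite perm_sym in pL'; rewrite perm_sym in pC'.
  by rewrite (perm_nilP pL') (perm_nilP pC'); apply: derives_nil.
apply: (@derives_step _ _ r L2 C2) D.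
  by rewrite -(permPl pL').
by rewrite -(permPl pC').
Qed.

Lemma derives_cat L C L' C' :
  derives L C -> derives L' C' -> derives (L ++ L') (C ++ C').
Proof.
elim=> [|L1 C1 r L2 C2 pL pC _ IH] // D'.
apply: (@derives_step _ _ r (L2 ++ L') (C2 ++ C')).
- by rewrite (permPl (perm_cat pL (perm_refl L'))).
- by rewrite (permPl (perm_cat pC (perm_refl C'))).
- by rewrite catA; apply: IH.
Qed.

Lemma perm_heads L L' : perm_eq L L' -> perm_eq (heads L) (heads L').
Proof. exact: perm_map. Qed.

Lemma perm_products L L' : perm_eq L L' -> perm_eq (products L) (products L').
Proof. by move=> p; apply/perm_flatten/perm_map. Qed.

(** The analogue of equal in- and out-degrees along a closed trail: each occurrence of a nonterminal
    is expanded exactly once. *)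
Lemma derives_balance L C : derives L C -> perm_eq (C ++ products L) (heads L).
Proof.
elim=> [|L1 C1 r L2 C2 pL pC _ IH] //.
rewrite (permPr (perm_heads pL)) (permPl (perm_cat pC (perm_products pL))) /=.
by rewrite perm_cons /products /= perm_catCA catA.
Qed.

(** [K] is a detour from [Y] back to [Y], inserted at the moment when the derivation expands [Y]. *)
Lemma derives_insert K Y L C :
  (forall L' C', derives L' (Y :: C') -> derives (K ++ L') (Y :: C')) ->
  derives L C -> Y \in heads L -> derives (K ++ L) C.
Proof.
move=> HK; elim=> [|L1 C1 r L2 C2 pL pC D IH] //.
rewrite (perm_mem (perm_heads pL)) inE => /orP[/eqP YE|YL2].
  have DL : derives L1 (Y :: C2) by rewrite YE; apply: derives_step pL _ D.
  by apply: derives_perm (HK _ _ DL) (perm_refl _) _; rewrite YE perm_sym.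
apply: (@derives_step _ _ r (K ++ L2) C2) (IH YL2) => //.
by rewrite (permPl (perm_cat (perm_refl K) pL)) -cat1s perm_catCA.
Qed.

Lemma greedy_derives L C : perm_eq (C ++ products L) (heads L) ->
  exists L1 L2, perm_eq L (L1 ++ L2) /\ derives L1 C.
Proof.
have [n] := ubnP (size L); elim: n L C => // n IH L [|X C] sL bal.
  by exists [::], L; split; rewrite ?perm_refl //; apply: derives_nil.
have /mapP[r rL XE] : X \in heads L by rewrite -(perm_mem bal) mem_head.
have pL := perm_to_rem rL; set L' := rem r L in pL.
have [||L1 [L2 [pL' D]]] := IH L' (rhs r ++ C).
- by move: sL; rewrite (perm_size pL) /= ltnS.
- move: bal; rewrite (permPr (perm_heads pL)).
  rewrite (permPl (perm_cat (perm_refl _) (perm_products pL))) /= -XE perm_cons.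
  by rewrite /products /= perm_catCA catA.
exists (r :: L1), L2; split; first by rewrite (permPl pL) perm_cons.
by apply: (@derives_step _ _ r L1 C) D => //; rewrite XE.
Qed.

Lemma balance_cat C L1 L2 L :
  perm_eq L (L1 ++ L2) -> perm_eq (C ++ products L) (heads L) ->
  perm_eq (C ++ products L1) (heads L1) -> perm_eq (products L2) (heads L2).
Proof.
move=> pL; rewrite (permPr (perm_heads pL)).
rewrite (permPl (perm_cat (perm_refl _) (perm_products pL))).
rewrite /heads /products !map_cat flatten_cat catA => b b1.
by move: b; rewrite (permPl (perm_cat b1 (perm_refl _))) perm_cat2l.
Qed.

Definition leads L : rel N := fun Y Z => has (fun r => (lhs r == Y) && (Z \in rhs r)) L.

(** Along the path a single nonterminal is followed; [G] collects the other symbols produced on the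
    way. *)
Lemma chain_derives (L : seq R) Y p : path (leads L) Y p ->
  exists K G, [/\ {subset K <= L}, heads K = belast Y p,
    perm_eq (Y :: products K) (heads K ++ last Y p :: G) &
    forall L' C', derives L' (last Y p :: G ++ C') -> derives (K ++ L') (Y :: C')].
Proof.
elim: p Y => [|Z p IH] Y /=; first by exists [::], [::].
move=> /andP[/hasP[r rL /andP[/eqP rY Zr]] pZ].
have [K [G [sK hK bK DK]]] := IH Z pZ.
have pr := perm_to_rem Zr; set G' := rem Z _ in pr.
exists (r :: K), (G ++ G'); split.
- by move=> x; rewrite inE => /orP[/eqP->|/sK].
- by rewrite /= hK rY.
- rewrite /= rY perm_cons /products /= (permPl (perm_cat pr (perm_refl _))).
  by rewrite -!cat_cons catA -(permPr (perm_cat bK (perm_refl G'))) /= perm_cons perm_catC.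
- move=> L' C' D.
  apply: (@derives_step _ _ r (K ++ L') C'); rewrite ?rY //.
  have := DK L' (G' ++ C'); rewrite -(catA G) in D => /(_ D) D1.
  apply: derives_perm D1 (perm_refl _) _.
  by rewrite -cat_cons; apply: perm_cat; rewrite // perm_sym.
Qed.

(** If the predecessor of [a] is another element [b], then [a] can be bypassed by transitivity and
    removed from the list. *)
Lemma transitive_loop (T : N -> N -> Prop) (s : seq N) :
  (forall x y z, T x y -> T y z -> T x z) -> s != [::] ->
  (forall y, y \in s -> exists2 x, x \in s & T x y) -> exists2 y, y \in s & T y y.
Proof.
move=> trT; elim: s => // a s IH _ Hs.
have [b] := Hs a (mem_head _ _).
rewrite inE => /orP[/eqP->|bs] Tba; first by exists a; rewrite ?mem_head.
have [||y ys Tyy] := IH; first by case: (s) bs.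
  move=> y ys; have [|x] := Hs y; first by rewrite inE ys orbT.
  rewrite inE => /orP[/eqP->|xs] Txy; last by exists x.
  by exists b => //; apply: trT Txy.
by exists y; rewrite // inE ys orbT.
Qed.

Definition feeds L Y Z := exists p, [/\ p != [::], path (leads L) Y p & last Y p = Z].

Lemma feeds_trans L Y Z W : feeds L Y Z -> feeds L Z W -> feeds L Y W.
Proof.
move=> [p [p0 pp lp]] [q [q0 pq lq]]; exists (p ++ q).
by rewrite cat_path pp last_cat lp; split=> //; case: (p) p0.
Qed.

Lemma perm_uniq_subset (K L : seq R) : uniq K -> {subset K <= L} ->
  exists L', perm_eq L (K ++ L').
Proof.
move=> uK sK.
have /count_subseqP[K' /perm_to_subseq[L' pL] pK] :
    forall x, count_mem x K <= count_mem x L.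
  move=> x; rewrite count_uniq_mem //; case xK: (x \in K) => //=.
  by rewrite -has_count has_pred1 sK.
by exists L'; rewrite (permPl pL) perm_cat2r perm_sym.
Qed.

(** Reachability of all heads from [C], phrased through the sets that are closed under the rules. *)
Definition connected_from C L := forall Z : pred N, {subset C <= Z} ->
  (forall r, r \in L -> lhs r \in Z -> {subset rhs r <= Z}) -> {subset heads L <= Z}.

Lemma derives_connected L C : derives L C -> connected_from C L.
Proof.
elim=> [|L1 C1 r L2 C2 pL pC _ IH] Z CZ LZ //.
have rZ : lhs r \in Z by apply: CZ; rewrite (perm_mem pC) mem_head.
move=> X; rewrite (perm_mem (perm_heads pL)) inE => /orP[/eqP->|] //.
apply: IH => [Y|q qL].
  rewrite mem_cat => /orP[|YC]; last by apply: CZ; rewrite (perm_mem pC) inE YC orbT.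
  by apply: LZ => //; rewrite (perm_mem pL) mem_head.
by apply: LZ; rewrite (perm_mem pL) inE qL orbT.
Qed.

(* A leftover [L2] consists of rules whose heads and products agree; connectedness
   yields a loop of [L2] through a nonterminal [Y] expanded by [L1], and firing that loop
   when [Y] is present, then discharging its by-products greedily, enlarges [L1]. *)
Theorem balanced_derives L C :
  perm_eq (C ++ products L) (heads L) -> connected_from C L -> derives L C.
Proof.
move=> bal conn.
have [L1 [L2 [pL D]]] := greedy_derives bal.
have [n] := ubnP (size L2); elim: n L1 L2 pL D => // n IH L1 L2 pL D sL2.
have [L20|L20] := eqVneq L2 [::].
  by apply: derives_perm D _ (perm_refl _); rewrite perm_sym -(cats0 L1) -L20.
have b2 := balance_cat pL bal (derives_balance D).
have V1 X : (X \in C) || (X \in products L1) = (X \in heads L1).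
  by rewrite -mem_cat (perm_mem (derives_balance D)).
(* The nonterminals at which leftover rules can be inserted into the derivation by [L1]. *)
pose s := [seq X <- heads L2 | X \in heads L1].
have leadsP r X : r \in L2 -> X \in rhs r -> leads L2 (lhs r) X.
  by move=> rL Xr; apply/hasP; exists r; rewrite // eqxx.
pose fed X := X \in s \/ exists2 Y, Y \in s & feeds L2 Y X.
have from_s X : X \in heads L2 -> fed X.
  (* Connectedness is applied to the heads of [L1] together with everything fed from [s]. *)
  pose Z X := (X \in heads L1) || excluded_middle_informative (fed X) : bool.
  have fedZ Y : fed Y -> Y \in Z.
    by move=> fY; rewrite unfold_in /Z; case: excluded_middle_informative => [?|//]; rewrite orbT.
  move=> X2; have : X \in Z.
    apply: conn => [Y YC|r|].
    - by rewrite unfold_in /Z -V1 YC.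
    - rewrite (perm_mem pL) mem_cat => /orP[rL1 _ Y Yr|rL2 rZ Y Yr].
        rewrite unfold_in /Z -V1 (_ : Y \in products L1) ?orbT //.
        by apply/flatten_mapP; exists r.
      have rY : feeds L2 (lhs r) Y by exists [:: Y]; rewrite /= leadsP.
      apply: fedZ; right; case/orP: rZ => [r1|].
        by exists (lhs r) => //; rewrite mem_filter r1 map_f.
      case: excluded_middle_informative => // -[rs|[W Ws Wr]] _; first by exists (lhs r).
      by exists W => //; apply: feeds_trans rY.
    - by rewrite (perm_mem (perm_heads pL)) /heads map_cat mem_cat X2 orbT.
  rewrite unfold_in /Z; case/orP => [X1|]; last by case: excluded_middle_informative.
  by left; rewrite mem_filter X1.
have [Y Ys [p [p0 pp lp]]] : exists2 Y, Y \in s & feeds L2 Y Y.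
  apply: transitive_loop; first exact: feeds_trans.
    have [r rL] : exists r, r \in L2 by case: (L2) L20 => // r ? _; exists r; rewrite mem_head.
    have [|[Y]] := from_s (lhs r) (map_f _ rL); by case: (s).
  move=> Y; rewrite mem_filter => /andP[_ Y2].
  have /flatten_mapP[r rL Yr] : Y \in products L2 by rewrite (perm_mem b2).
  have rY : feeds L2 (lhs r) Y.
    by exists [:: Y]; rewrite /= leadsP.
  case: (from_s (lhs r)) => [|rs|[Z Zs Zr]].
  - exact: map_f.
  - by exists (lhs r).
  - by exists Z => //; apply: feeds_trans rY.
(* The loop is made simple: then its rules have distinct heads and can be taken out of the multiset
   [L2] together. *)
case/lastP: p p0 pp lp => // p Z _; rewrite rcons_path last_rcons => /andP[pp eZ] ZY.
subst Z; case/shortenP: pp eZ => q pq uq _ eY.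
have pY : path (leads L2) Y (rcons q Y) by rewrite rcons_path pq.
have [K [G []]] := chain_derives pY.
rewrite belast_rcons last_rcons => sK hK bK DK.
have uK : uniq K by apply: (@map_uniq _ _ lhs); rewrite -/(heads K) hK.
have [L2' pL2] := perm_uniq_subset uK sK.
(* What remains of [L2] is balanced against the by-products [G], which can therefore be discharged
   greedily. *)
have bG : perm_eq (G ++ products L2') (heads L2').
  move: b2; rewrite (permPl (perm_products pL2)) (permPr (perm_heads pL2)).
  rewrite /products /heads !map_cat flatten_cat => b2.
  rewrite -(perm_cat2l (heads K)) -(permPr b2) catA perm_cat2r perm_sym.
  by rewrite -(perm_cons Y) (permPl bK) -cat1s perm_catCA.
have [G1 [L3 [pG DG]]] := greedy_derives bG.
apply: (IH ((K ++ G1) ++ L1) L3).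
- rewrite (permPl pL); apply: perm_trans (_ : perm_eq (L1 ++ K ++ G1 ++ L3) _).
    by rewrite perm_cat2l (permPl pL2) perm_cat2l.
  by rewrite perm_catCA -!catA perm_cat2l perm_catCA.
- apply: (derives_insert (Y := Y)) D _; last by move: Ys; rewrite mem_filter => /andP[].
  move=> L' C' D'; rewrite -catA; apply: DK.
  apply: derives_perm (derives_cat DG D') (perm_refl _) _.
  by rewrite (perm_catCA G [:: Y] C').
- have := perm_size pL2; have := perm_size pG; rewrite !size_cat.
  have : size K != 0 by rewrite -(size_map lhs) -/(heads K) hK.
  by move: sL2; clear; lia.
Qed.

End Derivation.

(** * Short Dyck paths *)

(* The letter [2 j] stands for the [j]-th free generator and [2 j + 1] for its inverse. *)
Definition letter_inv (a : nat) := if odd a then a.-1 else a.+1.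

Lemma letter_invK : involutive letter_inv.
Proof.
move=> a; rewrite /letter_inv; case oa: (odd a); last by rewrite /= oa.
by case: a oa => //= a; rewrite -[odd a]negbK => /negbTE->.
Qed.

(** Two-sided Dyck words, any letter being an opening bracket for its inverse: these are the words
    that reduce freely to the empty one. *)
Inductive dyck : seq nat -> Prop :=
| dyck_nil : dyck [::]
| dyck_cons a u v : dyck u -> dyck v -> dyck (a :: u ++ letter_inv a :: v).

(** Traces a letter of the word spelled by a path back to the edge that carries it. *)
Lemma pmap_cat_inv (E : Type) (f : E -> option nat) es u b v :
  pmap f es = u ++ b :: v -> exists es1 e es2,
    [/\ es = es1 ++ e :: es2, f e = Some b, pmap f es1 = u & pmap f es2 = v].
Proof.
elim: es u => [|e es IH] u /=; first by case: u.
case fe: (f e) => [c|] /=; last first.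
  by move=> /IH[es1 [e1 [es2 [-> fe1 <- <-]]]]; exists (e :: es1), e1, es2; rewrite /= fe.
case: u => [|c' u] /= [cE E1]; subst c; first by exists [::], e, es; rewrite E1.
have [es1 [e1 [es2 [-> fe1 <- <-]]]] := IH _ E1.
by exists (e :: es1), e1, es2; rewrite /= fe.
Qed.

Section LetterAutomaton.
Variables (T E : eqType) (src dst : E -> T) (let_of : E -> option nat).
Variable (wt : nat -> E -> int).

Fixpoint epath (p : T) (es : seq E) (q : T) : bool :=
  if es is e :: es' then (src e == p) && epath (dst e) es' q else p == q.

Lemma epath_cat p es es' q : epath p (es ++ es') q ->
  exists2 r, epath p es r & epath r es' q.
Proof.
elim: es p => [|e es IH] p /=; first by exists p.
by move=> /andP[-> /IH[r er rq]]; exists r.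
Qed.

Lemma cat_epath p es es' q r : epath p es r -> epath r es' q -> epath p (es ++ es') q.
Proof.
elim: es p => [|e es IH] p /=; first by move/eqP->.
by move=> /andP[-> /IH H] /H.
Qed.

Definition rule := ((T * T) * seq (T * T) * seq E)%type.
Definition rule_head (r : rule) := r.1.1.
Definition rule_body (r : rule) := r.1.2.
Definition rule_edges (r : rule) := r.2.

(** The pair [(p, q)] generates the Dyck paths from [p] to [q]. A rule splits such a path at its
    first edge and, if this edge carries a letter, at the edge cancelling it. *)
Definition end_rule p : rule := ((p, p), [::], [::]).
Definition step_rule e q : rule := ((src e, q), [:: (dst e, q)], [:: e]).
Definition cancel_rule e1 e2 q : rule :=
  ((src e1, q), [:: (dst e1, src e2); (dst e2, q)], [:: e1; e2]).

Definition rules (St : seq T) (Es : seq E) : seq rule :=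
  [seq end_rule p | p <- St]
  ++ [seq step_rule e q | e <- [seq e <- Es | let_of e == None], q <- St]
  ++ [seq cancel_rule ee.1 ee.2 q |
       ee <- [seq ee <- [seq (e1, e2) | e1 <- Es, e2 <- Es] |
               if let_of ee.1 is Some a then let_of ee.2 == Some (letter_inv a) else false],
       q <- St].

Inductive rule_spec (St : seq T) (Es : seq E) : rule -> Prop :=
| EndRule p : p \in St -> rule_spec St Es (end_rule p)
| StepRule e q : e \in Es -> q \in St -> let_of e = None -> rule_spec St Es (step_rule e q)
| CancelRule e1 e2 q a : e1 \in Es -> e2 \in Es -> q \in St -> let_of e1 = Some a ->
    let_of e2 = Some (letter_inv a) -> rule_spec St Es (cancel_rule e1 e2 q).

Lemma rulesP St Es r : r \in rules St Es <-> rule_spec St Es r.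
Proof.
rewrite !mem_cat; split.
  case/or3P.
  - by case/mapP => p ps ->; apply: EndRule.
  - case/allpairsP => -[e q] /= [+ qs ->]; rewrite mem_filter => /andP[/eqP le eE].
    exact: StepRule.
  - case/allpairsP => -[ee q] /= [+ qs ->]; rewrite mem_filter => /andP[+ /allpairsP[[e1 e2]]].
    case: ee => f1 f2 /= c [/= e1E e2E [? ?]]; subst f1 f2.
    by case l1: (let_of e1) c => [a|] // /eqP l2; apply: (CancelRule e1E e2E qs l1 l2).
case=> [p ps|e q eE qs le|e1 e2 q a e1E e2E qs l1 l2].
- by rewrite map_f.
- by apply/or3P/Or32/allpairsP; exists (e, q); rewrite mem_filter le eE.
- apply/or3P/Or33/allpairsP; exists ((e1, e2), q); rewrite mem_filter /= l1 l2 eqxx /=.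
  by split=> //; apply/allpairsP; exists (e1, e2).
Qed.

Lemma size_rules_leq St Es s n : size St <= s -> size Es <= n ->
  size (rules St Es) <= s + n * s + n * n * s.
Proof.
move=> ss nn; rewrite !size_cat size_map !size_allpairs addnA.
rewrite !leq_add // leq_mul // size_filter (leq_trans (count_size _ _)) //.
by rewrite size_allpairs leq_mul.
Qed.

Notation letters := (pmap let_of).
Notation rderives := (derives rule_head rule_body).

Lemma derives_of_dyck (St : seq T) (Es : seq E) p es q :
  {subset es <= Es} -> p \in St -> q \in St ->
  (forall e, e \in Es -> (src e \in St) && (dst e \in St)) ->
  epath p es q -> dyck (letters es) ->
  exists L, [/\ rderives L [:: (p, q)], {subset L <= rules St Es} &
    perm_eq (flatten (map rule_edges L)) es].
Proof.
move=> esE pS qS ES.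
have [n] := ubnP (size es); elim: n es p q pS qS esE => // n IH [|e es] p q pS qS esE sn /=.
  move=> /eqP-> _; exists [:: end_rule q]; split=> //.
    by apply: (@derives_step _ _ _ _ _ _ (end_rule q) [::] [::]) => //; apply: derives_nil.
  by move=> r; rewrite inE => /eqP->; apply/rulesP/EndRule.
have eE : e \in Es by apply: esE; rewrite mem_head.
have /andP[sS dS] := ES _ eE.
have esE' : {subset es <= Es} by move=> x xs; apply: esE; rewrite inE xs orbT.
move=> /andP[/eqP sp pe]; case le: (let_of e) => [a|] /= dy; last first.
  have [L [DL LR pL]] := IH es (dst e) q dS qS esE' sn pe dy.
  exists (step_rule e q :: L); split.
  - by apply: (@derives_step _ _ _ _ _ _ (step_rule e q) L [::]) => //=; rewrite /rule_head /= sp.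
  - by move=> r; rewrite inE => /orP[/eqP->|/LR //]; apply/rulesP/StepRule.
  - by rewrite /= perm_cons.
move E1 : (a :: letters es) dy => w dy; case: dy E1 => // a' u v du dv [<-] Ees.
(* The edge [e2] cancelling [e] cuts the path into two shorter Dyck paths. *)
have [es1 [e2 [es2 [E2 le2 lu lv]]]] := pmap_cat_inv Ees.
subst es u v; have [r e1r /= /andP[/eqP s2 pe2]] := epath_cat pe.
have e2E : e2 \in Es by apply: esE'; rewrite mem_cat mem_head orbT.
have /andP[s2S d2S] := ES _ e2E.
move: sn; rewrite /= size_cat /= => sn.
rewrite -s2 in e1r.
have [||L1 [DL1 LR1 pL1]] := IH es1 (dst e) (src e2) dS s2S _ _ e1r du.
- by move=> x xs; apply: esE'; rewrite mem_cat xs.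
- by move: sn; clear; lia.
have [||L2 [DL2 LR2 pL2]] := IH es2 (dst e2) q d2S qS _ _ pe2 dv.
- by move=> x xs; apply: esE'; rewrite mem_cat inE xs !orbT.
- by move: sn; clear; lia.
exists (cancel_rule e e2 q :: L1 ++ L2); split.
- apply: (@derives_step _ _ _ _ _ _ (cancel_rule e e2 q) (L1 ++ L2) [::]) => //=.
    by rewrite /rule_head /= sp.
  exact: (derives_cat DL1 DL2).
- move=> x; rewrite inE mem_cat => /or3P[/eqP->|/LR1 //|/LR2 //].
  exact/rulesP/(CancelRule eE e2E qS le le2).
- by rewrite /= perm_cons map_cat flatten_cat -cat1s perm_catCA /= -cat1s perm_cat // perm_cons.
Qed.

Definition good (z : (T * T) * seq E) := epath z.1.1 z.2 z.1.2 /\ dyck (letters z.2).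

(** The semantics of a form: one Dyck path for each pair, all of them together using the multiset
    [W] of edges. *)
Definition yields (C : seq (T * T)) (W : seq E) := exists Z,
  [/\ perm_eq C [seq z.1 | z <- Z], perm_eq W (flatten [seq z.2 | z <- Z]) &
    forall z, z \in Z -> good z].

Lemma yields_cons X C W : yields (X :: C) W <->
  exists es W', [/\ good (X, es), yields C W' & perm_eq W (es ++ W')].
Proof.
split=> [[Z [pC pW gZ]]|[es [W' [ges [Z [pC pW' gZ]] pW]]]]; last first.
  exists ((X, es) :: Z); split; rewrite /= ?perm_cons //.
    by rewrite (permPl pW) perm_cat2l.
  by move=> z; rewrite inE => /orP[/eqP->|/gZ].
have /mapP[z zZ XE] : X \in [seq z.1 | z <- Z] by rewrite -(perm_mem pC) mem_head.
have pZ := perm_to_rem zZ; exists z.2, (flatten [seq y.2 | y <- rem z Z]); split.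
- by rewrite XE -surjective_pairing; apply: gZ.
- exists (rem z Z); split=> // [|y /mem_rem/gZ //].
  by move: pC; rewrite (permPr (perm_map _ pZ)) /= -XE perm_cons.
- by rewrite (permPl pW); apply: (perm_flatten (perm_map _ pZ)).
Qed.

Lemma yields_perm C C' W W' : perm_eq C C' -> perm_eq W W' -> yields C W -> yields C' W'.
Proof.
move=> pC pW [Z [pCZ pWZ gZ]]; exists Z; split=> //.
  by rewrite -(permPl pC).
by rewrite -(permPl pW).
Qed.

(** Each rule glues paths: a step edge is put in front of a path, and a cancelling pair encloses one
    path and is followed by another. *)
Lemma yields_of_derives (St : seq T) (Es : seq E) L C :
  rderives L C -> {subset L <= rules St Es} -> yields C (flatten (map rule_edges L)).
Proof.
elim=> [|L1 C1 r L2 C2 pL pC D IH] LR; first by exists [::]; split.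
have /IH{}IH : {subset L2 <= rules St Es}.
  by move=> x xL; apply: LR; rewrite (perm_mem pL) inE xL orbT.
have := LR r; rewrite (perm_mem pL) mem_head => /(_ isT)/rulesP rS.
have pW : perm_eq (rule_edges r ++ flatten (map rule_edges L2)) (flatten (map rule_edges L1)).
  by rewrite perm_sym; apply: (perm_flatten (perm_map _ pL)).
rewrite perm_sym in pC; apply: yields_perm pC pW _.
case: rS IH => [p ps|e q eE qs le|e1 e2 q a e1E e2E qs l1 l2] /= IH.
- apply/yields_cons; exists [::], (flatten (map rule_edges L2)); split=> //.
  by split; rewrite /= ?eqxx //; apply: dyck_nil.
- case/yields_cons: IH => es [W [[/= pe de] Y pW']].
  apply/yields_cons; exists (e :: es), W; split; rewrite //= ?perm_cons //.
  by split; rewrite /= ?eqxx ?le.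
- case/yields_cons: IH => es1 [W1 [[/= pe1 de1] /yields_cons[es2 [W2 [[/= pe2 de2] Y pW2]]] pW1]].
  apply/yields_cons; exists (e1 :: es1 ++ e2 :: es2), W2; split=> //=.
    split; rewrite /= ?eqxx /=; first by apply: cat_epath pe1 _; rewrite /= eqxx.
    by rewrite l1 /= pmap_cat /= l2 /=; apply: dyck_cons.
  rewrite perm_cons -catA -cat1s.
  rewrite (permPl (perm_cat (perm_refl [:: e2]) (_ : perm_eq _ (es1 ++ (es2 ++ W2))))).
    by rewrite -cat1s perm_catCA.
  by rewrite (permPl pW1) perm_cat2l.
Qed.

(** With [n] edges there are at most [s = 2 n + 2] states, the two end points of the path included;
    the summands count the end, step and cancel rules. *)
Definition rule_count n := let s := 2 * n + 2 in s + n * s + n * n * s.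
Definition nonterminal_count n := (2 * n + 2) * (2 * n + 2).
(** A rule carries at most two edges. One copy of each of the at most [m] rules is kept, and the
    others come from one block of vectors having a coordinate for each pair of states and each
    weight. *)
Definition path_bound n d c :=
  let m := rule_count n in
  2 * (m + block_bound ((2 * m + 2) * (c + 1)) (nonterminal_count n + d)).

Lemma sum_count (I : Type) (f : I -> seq (T * T)) X s :
  Posz (count_mem X (flatten [seq f i | i <- s])) =
    (\sum_(i <- s) (count_mem X (f i))%:Z)%R.
Proof.
by elim: s => [|i s IH]; rewrite ?big_nil //= big_cons -IH count_cat PoszD.
Qed.

Lemma sum_wt_flatten i L :
  (\sum_(e <- flatten (map rule_edges L)) wt i e =
   \sum_(r <- L) \sum_(e <- rule_edges r) wt i e)%R.
Proof. by rewrite big_flatten_seq big_map. Qed.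

Lemma rule_size St Es r : r \in rules St Es ->
  size (rule_body r) <= 2 /\ size (rule_edges r) <= 2.
Proof. by case/rulesP. Qed.

Lemma perm_pmap_id (X : eqType) (b : seq (option X)) :
  perm_eq b (nseq (count_mem None b) None ++ map Some (pmap id b)).
Proof.
elim: b => //= -[x|] b IH; rewrite /= ?perm_cons //.
by rewrite add0n perm_sym (perm_catCA _ [:: Some x]) perm_cons perm_sym.
Qed.

Lemma rule_nonterminals (St : seq T) (Es : seq E) r :
  (forall e, e \in Es -> (src e \in St) && (dst e \in St)) ->
  r \in rules St Es -> {subset rule_head r :: rule_body r <= [seq (x, y) | x <- St, y <- St]}.
Proof.
move=> ES /rulesP[x xS|e y /ES/andP[sS dS] yS _|
  e1 e2 y a /ES/andP[sS dS] /ES/andP[sS' dS'] yS _ _] X;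
  rewrite /rule_head /rule_body /= !inE => H; apply/allpairsP.
- by move/eqP: H => ->; exists (x, x).
- by case/orP: H => /eqP->; [exists (src e, y) | exists (dst e, y)].
- by case/or3P: H => /eqP->; [exists (src e1, y) | exists (dst e1, src e2) | exists (dst e2, y)].
Qed.

(** The path is parsed into a multiset [L] of rules. One copy [B] of each rule preserves
    connectedness; the others are exchanged for a small multiset [rest'] with the same sum of
    vectors, hence the same balance and weights, and [balanced_derives] reassembles a path. *)
Theorem short_dyck_path es p q n d c :
  epath p es q -> dyck (letters es) -> size (undup es) <= n ->
  (forall i e, i < d -> e \in es -> bounded c (wt i e)) ->
  (forall i, i < d -> bounded c (\sum_(e <- es) wt i e)%R) ->
  exists es', [/\ epath p es' q, dyck (letters es'), {subset es' <= es},
    size es' <= path_bound n d c &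
    forall i, i < d -> (\sum_(e <- es') wt i e = \sum_(e <- es) wt i e)%R].
Proof.
move=> pe de sn bw bs.
set Es := undup es in sn.
pose St := p :: q :: map src Es ++ map dst Es.
have sSt : size St <= 2 * n + 2 by rewrite /= size_cat !size_map; lia.
have ES e : e \in Es -> (src e \in St) && (dst e \in St).
  by move=> eE; rewrite !inE !mem_cat !map_f ?orbT.
have [L [DL LR pL]] : exists L, [/\ rderives L [:: (p, q)], {subset L <= rules St Es} &
    perm_eq (flatten (map rule_edges L)) es].
  by apply: derives_of_dyck => //; rewrite ?inE ?eqxx ?orbT // => e; rewrite mem_undup.
pose m := rule_count n.
pose N := nonterminal_count n.
pose NT := [seq (x, y) | x <- St, y <- St].
have sNT : size NT <= N by rewrite size_allpairs leq_mul.
pose B := undup L.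
have sB : size B <= m.
  apply: leq_trans (size_rules_leq sSt sn).
  by apply: uniq_leq_size; rewrite ?undup_uniq // => r; rewrite mem_undup => /LR.
have [rest pB] : exists rest, perm_eq L (B ++ rest).
  by apply: perm_uniq_subset; rewrite ?undup_uniq // => r; rewrite mem_undup.
(* The first [N] coordinates record production minus consumption of a pair of states, the others the
   weights. If [NT] has fewer than [N] entries, the surplus coordinates repeat that of [(p, q)]. *)
pose nt i := nth (p, q) NT i.
pose g i (r : rule) : int := if i < N then
   ((count_mem (nt i) (rule_body r))%:Z - (rule_head r == nt i)%:Z)%R
  else (\sum_(e <- rule_edges r) wt (i - N) e)%R.
(* [None] stands for an additional vector making the total zero; the block that contains it yields a
   part of [rest] with the same sum as [rest]. *)
pose f i (x : option rule) : int :=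
  if x is Some r then g i r else (- \sum_(r <- rest) g i r)%R.
pose C := (2 * m + 2) * (c + 1).
have g_nt s i : i < N -> (\sum_(r <- s) g i r = Posz (count_mem (nt i) (products rule_body s))
    - Posz (count_mem (nt i) (heads rule_head s)))%R.
  move=> iN; rewrite sum_count /heads -(flatten_seq1 (map _ s)) -map_comp sum_count -sumrB.
  by apply: eq_bigr => r _; rewrite /g iN /= addn0.
have g_wt s i : N <= i -> (\sum_(r <- s) g i r =
    \sum_(e <- flatten (map rule_edges s)) wt (i - N) e)%R.
  by move=> iN; rewrite sum_wt_flatten; apply: eq_bigr => r _; rewrite /g ltnNge iN.
have gb i r : i < N + d -> r \in L -> bounded (2 * c + 2) (g i r).
  move=> iD rL; have [sb se] := rule_size (LR r rL).
  rewrite /g; case: ltnP => iN.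
    have := count_size (pred1 (nt i)) (rule_body r); move: (count _ _) sb => k.
    by rewrite /bounded; case: (rule_head r == _) => /=; lia.
  apply: bounded_leq (bounded_sum (C := c) _); first by nia.
  move=> e er; apply: bw; first by lia.
  by rewrite -(perm_mem pL); apply/flatten_mapP; exists r.
(* By balance, the total in a nonterminal coordinate is 0, or -1 at the start pair. Together with
   the bound on the sum over [B] this bounds the entries of [None]. *)
have totb i : i < N + d -> bounded (c + 1) (\sum_(r <- L) g i r)%R.
  move=> iD; case: (ltnP i N) => iN.
    rewrite g_nt //.
    have /permP/(_ (pred1 (nt i))) := derives_balance DL.
    by rewrite count_cat /= addn0 => <-; rewrite /bounded; case: ((p, q) == _) => /=; lia.
  rewrite g_wt // (perm_big _ pL); apply: bounded_leq (bs _ _); lia.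
have BL : {subset B <= L} by move=> r; rewrite mem_undup.
have restL : {subset rest <= L} by move=> r rr; rewrite (perm_mem pB) mem_cat rr orbT.
have fb i x : i < N + d -> x \in None :: map Some rest -> bounded C (f i x).
  move=> iD; rewrite inE => /orP[/eqP->|/mapP[r rr ->]] /=; last first.
    by apply: bounded_leq (gb i r iD (restL r rr)); rewrite /C; nia.
  have := totb i iD; rewrite (perm_big _ pB) big_cat /=.
  have : bounded ((2 * c + 2) * size B) (\sum_(r <- B) g i r)%R.
    by apply: bounded_sum => r /BL; apply: gb.
  move: (\sum_(r <- B) _)%R (\sum_(r <- rest) _)%R => u v.
  have := leq_mul (leqnn (2 * c + 2)) sB; rewrite /bounded /C; nia.
have f0 i : i < N + d -> (\sum_(x <- None :: map Some rest) f i x = 0)%R.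
  by move=> _; rewrite big_cons big_map /= addNr.
have [ss pss Hss] := zero_sum_blocks fb f0.
have /flattenP[b bss bN] : None \in flatten ss by rewrite -(perm_mem pss) mem_head.
have [sb b0] := Hss b bss.
pose rest' := pmap id b.
have pb : perm_eq b (None :: map Some rest').
  have := perm_pmap_id b; suff -> : count_mem None b = 1 by [].
  apply/eqP; rewrite eqn_leq -has_count has_pred1 bN andbT.
  have /permP/(_ (pred1 None)) := perm_flatten (perm_to_rem bss).
  have /permP/(_ (pred1 None)) := pss.
  rewrite /= count_cat count_map => <-.
  by rewrite (eq_count (a2 := pred0)) // count_pred0; lia.
have rest'P : {subset rest' <= rest}.
  move=> r; rewrite mem_pmap map_id => rb.
  have : Some r \in flatten ss by apply/flattenP; exists b.
  by rewrite -(perm_mem pss) inE /= mem_map // => x y [].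
have sum' i : i < N + d -> (\sum_(r <- B ++ rest') g i r = \sum_(r <- L) g i r)%R.
  move=> iD; rewrite (perm_big _ pB) /= !big_cat /=; congr (_ + _)%R.
  have := b0 i iD; rewrite (perm_big _ pb) big_cons big_map /= => /eqP.
  by rewrite addrC subr_eq0 => /eqP.
pose L' := B ++ rest'.
(* The same rules occur as in [L], with other multiplicities; so connectedness carries over. *)
have L'L : L' =i L.
  move=> r; rewrite mem_cat mem_undup; case rL: (r \in L) => //=.
  by apply/negP => /rest'P/restL; rewrite rL.
have nts r : r \in L -> {subset rule_head r :: rule_body r <= NT}.
  by move=> /LR; apply: rule_nonterminals.
have bal : perm_eq ([:: (p, q)] ++ products rule_body L') (heads rule_head L').
  apply/allP => X XIn; apply/eqP.
  have XNT : X \in NT.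
    rewrite !mem_cat inE in XIn; case/orP: XIn => [/orP[/eqP->|]|].
    - by apply/allpairsP; exists (p, q); rewrite /St !inE !eqxx orbT.
    - case/flatten_mapP => r rL Xr; have := nts r; rewrite -L'L rL => /(_ isT); apply.
      by rewrite inE Xr orbT.
    - case/mapP => r rL ->; have := nts r; rewrite -L'L rL => /(_ isT); apply.
      exact: mem_head.
  have iN : index X NT < N by rewrite (leq_trans _ sNT) // index_mem.
  have := sum' (index X NT); rewrite !g_nt // ltn_addr // => /(_ isT).
  rewrite /nt nth_index //.
  have /permP/(_ (pred1 X)) := derives_balance DL.
  rewrite !count_cat /= !addn0 -/L'; move: (_ == _) (count _ _) (count _ _) => u v w.
  by move: (count _ _) (count _ _) => v' w'; clear; lia.
have D' : rderives L' [:: (p, q)].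
  apply: balanced_derives bal _ => Z CZ LZ X.
  have hL : heads rule_head L' =i heads rule_head L by apply: eq_mem_map.
  by rewrite hL; apply: (derives_connected DL) => // r; rewrite -L'L; apply: LZ.
have L'R : {subset L' <= rules St Es} by move=> r; rewrite L'L; apply: LR.
have /yields_cons[es' [W [[/= pe' de'] [[|z Z] [pZ pW _]] pWW]]] := yields_of_derives D' L'R;
  last by have := perm_size pZ.
have pW' : perm_eq es' (flatten (map rule_edges L')).
  by rewrite (permPr pWW) -[X in perm_eq X _]cats0 perm_cat2l perm_sym.
exists es'; split=> //.
- move=> e; rewrite (perm_mem pW') => /flatten_mapP[r]; rewrite L'L => rL er.
  by rewrite -(perm_mem pL); apply/flatten_mapP; exists r.
- rewrite (perm_size pW'); apply: leq_trans (size_flatten_leq (m := 2) _) _.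
    by move=> _ /mapP[r /L'R/rule_size[_ H] ->].
  rewrite size_map size_cat leq_mul2l /= leq_add //.
  apply: leq_trans sb; rewrite (perm_size pb) /= size_map; exact: leqnSn.
- move=> i iD; have iN : N <= i + N by apply: leq_addl.
  have := sum' (i + N); rewrite !g_wt // addnK (perm_big _ pL) -/L' (perm_big _ pW') => -> //.
  by rewrite addnC ltn_add2l.
Qed.

End LetterAutomaton.

(** * Slices are semilinear *)

Section Slices.
Variable I : finType.
Notation V := {ffun I -> nat}.
Implicit Types (x y z v w : V) (S : V -> Prop).

Definition vadd x y : V := [ffun i => x i + y i].
Definition vsub x y : V := [ffun i => x i - y i].
Definition vzero : V := [ffun=> 0].
Definition vle x y := [forall i, x i <= y i].
Definition weight x := \sum_i x i.

Lemma vaddA : associative vadd.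
Proof. by move=> x y z; apply/ffunP => i; rewrite !ffunE addnA. Qed.

Lemma vaddC : commutative vadd.
Proof. by move=> x y; apply/ffunP => i; rewrite !ffunE addnC. Qed.

Lemma vaddCA : left_commutative vadd.
Proof. by move=> x y z; rewrite vaddA (vaddC x) -vaddA. Qed.

Lemma vadd0 : right_id vzero vadd.
Proof. by move=> x; apply/ffunP => i; rewrite !ffunE addn0. Qed.

Lemma vsubK x y : vle x y -> vadd x (vsub y x) = y.
Proof. by move/forallP => xy; apply/ffunP => i; rewrite !ffunE subnKC. Qed.

Lemma vle_add x y : vle x (vadd x y).
Proof. by apply/forallP => i; rewrite ffunE leq_addr. Qed.

Lemma weight_add x y : weight (vadd x y) = weight x + weight y.
Proof. by rewrite -big_split; apply: eq_bigr => i _; rewrite ffunE. Qed.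

Lemma weight_eq0 x : weight x = 0 -> x = vzero.
Proof.
move/eqP; rewrite sum_nat_eq0 => /forallP x0; apply/ffunP => i.
by rewrite ffunE; apply/eqP/(implyP (x0 i)).
Qed.

(** A point [x] of [S] splits off the cone above [x]. Any other point has some coordinate [i] with a
    value [c] less than [x i], and on each of these finitely many parts one more coordinate is
    constant. The induction is on the number of coordinates outside the set [J] of those known to be
    constant. *)
Lemma box_induction (K G : (V -> Prop) -> Prop) :
  (forall S S', (forall v, S v <-> S' v) -> G S -> G S') ->
  G (fun=> False) ->
  (forall S S', G S -> G S' -> G (fun v => S v \/ S' v)) ->
  (forall S i c, K S -> K (fun v => S v /\ v i = c)) ->
  (forall S, K S -> (exists v, S v) -> exists2 x, S x & G (fun v => S v /\ vle x v)) ->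
  forall S, K S -> G S.
Proof.
move=> Gext G0 GU Krestr Kmin S KS.
have GUs (T : eqType) (s : seq T) (A : T -> V -> Prop) : (forall t, t \in s -> G (A t)) ->
    G (fun v => exists2 t, t \in s & A t v).
  elim: s => [|t s IH] HA; first by apply: Gext G0 => v; split=> // -[].
  have GA : G (A t) by apply: HA; rewrite mem_head.
  have Gs : G (fun v => exists2 t, t \in s & A t v).
    by apply: IH => r rs; apply: HA; rewrite inE rs orbT.
  apply: Gext (GU _ _ GA Gs) => v; split.
    by case=> [Av|[r rs Av]]; [exists t; rewrite ?mem_head | exists r; rewrite // inE rs orbT].
  by case=> r; rewrite inE => /orP[/eqP->|rs] Av; [left | right; exists r].
have [n] := ubnP #|~: (set0 : {set I})|.
have : forall v w, S v -> S w -> forall i, i \in set0 -> v i = w i by move=> ? ? ? ? i; rewrite inE.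
elim: n S KS (set0 : {set I}) => // n IH S KS J SJ Jn.
have [[v0 Sv0]|S0] := classic (exists v, S v); last first.
  by apply: Gext G0 => v; split=> // Sv; apply: S0; exists v.
have [x Sx Gx] := Kmin S KS (ex_intro _ v0 Sv0).
(* The sum of all coordinates of [x] serves as a common bound for the values [c]. *)
pose cells := [seq (i, c) | i <- enum (~: J), c <- iota 0 (\sum_i x i)].
have /(GU _ _ Gx)/Gext : G (fun v => exists2 t, t \in cells & S v /\ v t.1 = t.2).
  apply: GUs => -[i c] /allpairsP[[i' c'] /= [+ _ [-> ->]]]; rewrite mem_enum inE => iJ.
  apply: (IH _ _ (i' |: J)); first exact: Krestr.
    move=> v w [Sv vi] [Sw wi] j; rewrite !inE => /orP[/eqP->|]; first by rewrite vi.
    exact: SJ.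
  rewrite -ltnS; apply: leq_trans Jn; rewrite ltnS; apply: proper_card.
  by rewrite properC properUr // sub1set.
apply=> v; split=> [[[]//|[t _ []//]]|Sv].
have [xv|] := boolP (vle x v); first by left.
rewrite negb_forall => /existsP[i]; rewrite -ltnNge => vi; right.
exists (i, v i) => //; apply/allpairsP; exists (i, v i); split=> //=.
  by rewrite mem_enum inE; apply/negP => /(SJ _ _ Sv Sx) E; rewrite E ltnn in vi.
by rewrite mem_iota /= (leq_trans vi) // (bigD1 i) //= leq_addr.
Qed.

Lemma dickson S : exists l : seq V, (forall u, u \in l -> S u) /\
  forall v, S v -> exists2 u, u \in l & vle u v.
Proof.
apply: (@box_induction (fun=> True) (fun S => exists l : seq V, (forall u, u \in l -> S u) /\
  forall v, S v -> exists2 u, u \in l & vle u v)) => //.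
- move=> S1 S2 E [l [lS Sl]]; exists l; split=> [u /lS/E //|v /E/Sl //].
- by exists [::].
- move=> S1 S2 [l1 [lS1 Sl1]] [l2 [lS2 Sl2]]; exists (l1 ++ l2); split=> [u|v].
    by rewrite mem_cat => /orP[/lS1|/lS2]; [left|right].
  by case=> [/Sl1|/Sl2] [u ul uv]; exists u; rewrite // mem_cat ul ?orbT.
- move=> S1 _ [x Sx]; exists x => //; exists [:: x]; split=> [u|v [_ xv]].
    by rewrite inE => /eqP->; split=> //; apply/forallP.
  by exists x; rewrite ?mem_head.
Qed.

(** The finitely many minimal vectors of the range occur up to some index [N], and one of them lies
    below [f N.+1]. *)
Lemma dickson_seq (f : nat -> V) : exists i j, i < j /\ vle (f i) (f j).
Proof.
have [l [lf fl]] := dickson (fun v => exists n, v = f n).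
have [N HN] : exists N, forall u, u \in l -> exists2 i, i <= N & u = f i.
  elim: l lf {fl} => [|u l IH] lf; first by exists 0.
  have [n un] := lf u (mem_head _ _).
  have [|N HN] := IH; first by move=> w wl; apply: lf; rewrite inE wl orbT.
  exists (maxn n N) => w; rewrite inE => /orP[/eqP->|/HN[i iN wi]].
    by exists n; rewrite // leq_maxl.
  by exists i; rewrite // leq_max iN orbT.
have [u /HN[i iN ->] le] := fl (f N.+1) (ex_intro _ N.+1 erefl).
by exists i, N.+1.
Qed.

Definition vsum (b : V) (s : seq V) := foldr vadd b s.

Definition linear_set (b : V) (ps : seq V) v := exists2 s : seq V, {subset s <= ps} & v = vsum b s.

Definition semilinear S := exists L : seq (V * seq V),
  forall v, S v <-> exists2 bp, bp \in L & linear_set bp.1 bp.2 v.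

Definition slice S := forall x y z,
  S x -> S (vadd x y) -> S (vadd x z) -> S (vadd (vadd x y) z).

Section MaximalBase.
Variable S : V -> Prop.
Hypothesis sliceS : slice S.

(** The eventual periods of [S] above [x]. For [x] in [S] they form a monoid closed under
    differences, and they grow when [x] moves up within [S]. *)
Definition quotients x z := exists y, S (vadd x y) /\ S (vadd (vadd x y) z).

Lemma quotients_mono x y z : S x -> S (vadd x y) -> quotients x z -> quotients (vadd x y) z.
Proof.
move=> Sx Sy [w [Sw Swz]]; exists w; split; first exact: sliceS.
by rewrite -[vadd (vadd _ _) z]vaddA; apply: sliceS; rewrite ?vaddA.
Qed.

Lemma quotients_add x z z' : S x -> quotients x z -> quotients x z' -> quotients x (vadd z z').
Proof.
move=> Sx [y [Sy Syz]] [y' [Sy' Syz']]; exists (vadd y y').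
rewrite -!vaddA in Syz Syz' *; rewrite (vaddCA y') vaddA [vadd y (vadd z _)]vaddA vaddA.
by split; apply: sliceS.
Qed.

Lemma quotients_sub x z t : S x -> quotients x z -> quotients x (vadd z t) -> quotients x t.
Proof.
move=> Sx [y [Sy Syz]] [y' [Sy' Syz']]; exists (vadd (vadd y z) y').
rewrite -!vaddA in Syz Syz' *; split.
  by rewrite [vadd y _]vaddA vaddA; apply: sliceS.
by rewrite (vaddCA z) vaddA; apply: sliceS.
Qed.

Lemma quotients0 x : S x -> quotients x vzero.
Proof. by exists vzero; rewrite !vadd0. Qed.

Lemma min_weight (P : V -> Prop) : (exists v, P v) ->
  exists2 v, P v & forall w, P w -> weight v <= weight w.
Proof.
move=> exP; have exn : exists n, excluded_middle_informative (exists2 v, P v & weight v = n) : bool.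
  case: exP => v Pv; exists (weight v); case: excluded_middle_informative => // -[].
  by exists v.
case: (ex_minnP exn) => n; case: excluded_middle_informative => // -[v Pv wv] _ Hmin.
exists v => // w Pw; rewrite wv; apply: Hmin; case: excluded_middle_informative => // -[].
by exists w.
Qed.

(** Otherwise there is an infinite chain of bases [xs n], each step adding a new eventual period
    [zs n] chosen of least weight. Dickson's lemma gives [zs i] below [zs j], and their difference
    is new at step [j] as well. *)
Lemma maximal_quotients : (exists x, S x) -> exists2 x, S x &
  forall y z, S (vadd x y) -> quotients (vadd x y) z -> quotients x z.
Proof.
move=> [x0 Sx0]; case: (classic (exists2 x, S x &
  forall y z, S (vadd x y) -> quotients (vadd x y) z -> quotients x z)) => // noX.
have grow x : exists yz : V * V, S x -> [/\ S (vadd x yz.1), quotients (vadd x yz.1) yz.2,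
    ~ quotients x yz.2 & forall z, quotients (vadd x yz.1) z -> ~ quotients x z ->
      weight yz.2 <= weight z].
  have [Sx|nSx] := classic (S x); last by exists (x, x).
  have [[y [Sy [z Pz]]]|no] := classic (exists y, S (vadd x y) /\ exists z,
      quotients (vadd x y) z /\ ~ quotients x z).
    have [|z0 [Qz0 nQz0] Hmin] := @min_weight (fun z => quotients (vadd x y) z /\ ~ quotients x z).
      by exists z.
    by exists (y, z0) => _; split=> // w Qw nQw; apply: Hmin.
  case: noX; exists x => // y z Sy Qz; apply: NNPP => nQ; apply: no.
  by exists y; split=> //; exists z.
have [f Hf] := choice _ grow.
pose xs := fix xs n := if n is n'.+1 then vadd (xs n') (f (xs n')).1 else x0.
have Sxs n : S (xs n) by elim: n => //= n /Hf[].
pose zs n := (f (xs n)).2.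
have mono i j z : i <= j -> quotients (xs i) z -> quotients (xs j) z.
  move=> ij Qi; elim: j ij => [|j IH]; first by rewrite leqn0 => /eqP<-.
  rewrite leq_eqVlt => /orP[/eqP<- //|]; rewrite ltnS => /IH Qj.
  by case: (Hf _ (Sxs j)) => Sj _ _ _; apply: quotients_mono.
have [i [j [ij zij]]] := dickson_seq zs.
have [_ Qi nQi _] := Hf _ (Sxs i); have [_ Qj nQj minj] := Hf _ (Sxs j).
set t := vsub (zs j) (zs i).
have Et : vadd (zs i) t = zs j by apply: vsubK.
have Qt : quotients (xs j.+1) t.
  apply: (@quotients_sub _ (zs i)) => //; first by apply: (mono i.+1) => //; apply: ltnW.
  by rewrite Et.
have nQt : ~ quotients (xs j) t.
  move=> Qt'; case: nQj; rewrite -/(zs j) -Et; apply: quotients_add => //.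
  exact: (mono i.+1).
(* Minimality of the weight of [zs j] forces [zs i] to be zero, but zero is an eventual period of
   every base in [S]. *)
have := minj t Qt nQt; rewrite -/(zs j) -Et weight_add => wle.
case: nQi; rewrite -/(zs i) (weight_eq0 (x := zs i)); first exact: quotients0.
by lia.
Qed.

(** At a maximal base the minimal nonzero eventual periods generate all the others by subtraction.
    The base is then moved up until these generators are periods without delay. *)
Lemma linear_upper_part : (exists x, S x) -> exists2 x, S x &
  exists l, forall v, S v /\ vle x v <-> linear_set x l v.
Proof.
move=> /maximal_quotients[x Sx Hx].
have [l [lQ Ql]] := dickson (fun z => quotients x z /\ z <> vzero).
have gen z : quotients x z -> exists2 s : seq V, {subset s <= l} & z = vsum vzero s.
  have [n] := ubnP (weight z); elim: n z => // n IH z wz Qz.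
  have [->|z0] := eqVneq z vzero; first by exists [::].
  have [u ul uz] := Ql z (conj Qz (elimN eqP z0)).
  have [Qu u0] := lQ u ul.
  have E := vsubK uz.
  have [||s sl Es] := IH (vsub z u).
  - have wu : weight u != 0 by apply/eqP => /weight_eq0.
    by have := weight_add u (vsub z u); rewrite E; lia.
  - by apply: (@quotients_sub _ u) => //; rewrite E.
  exists (u :: s) => [w|]; first by rewrite inE => /orP[/eqP->|/sl].
  by rewrite /= -Es E.
(* The shifts witnessing the single generators add up to one common shift. *)
have [y Sy Hy] : exists2 y, S (vadd x y) & forall h, h \in l -> S (vadd (vadd x y) h).
  have : forall h, h \in l -> quotients x h by move=> h /lQ[].
  elim: (l) => [|h l' IH] Hl; first by exists vzero; rewrite ?vadd0.
  have [|y Sy Hy] := IH; first by move=> w wl; apply: Hl; rewrite inE wl orbT.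
  have [b [Sb Sbh]] := Hl h (mem_head _ _).
  exists (vadd b y); first by rewrite vaddA; apply: sliceS.
  move=> w; rewrite inE => /orP[/eqP->|/Hy Sw].
    rewrite -!vaddA in Sbh *.
    by rewrite (vaddC y) [vadd b _]vaddA vaddA; apply: sliceS.
  by rewrite -!vaddA in Sw *; rewrite vaddA; apply: sliceS.
exists (vadd x y) => //; exists l => v; split=> [[Sv /vsubK E]|[s sl ->]].
  have [|s sl Es] := gen (vsub v (vadd x y)).
    (* The difference is a period above [vadd x y] with shift zero; by maximality it is already an
       eventual period of [x]. *)
    by apply: (Hx y) => //; exists vzero; rewrite !vadd0 E.
  exists s => //; rewrite -{1}E Es; elim: s {sl Es} => /= [|a s <-]; first exact: vadd0.
  exact: vaddCA.
elim: s sl => [|a s IH] sl; first by split=> //; apply/forallP.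
have [|Ss les] := IH; first by move=> w ws; apply: sl; rewrite inE ws orbT.
have la : a \in l by apply: sl; rewrite mem_head.
split; last first.
  by apply/forallP => i; rewrite /= [leqRHS]ffunE (leq_trans (forallP les i)) ?leq_addl.
rewrite /= -/(vsum _ s) -(vsubK les) vaddC; apply: sliceS => //; last exact: Hy.
by rewrite vsubK.
Qed.

End MaximalBase.

Theorem slice_semilinear S : slice S -> semilinear S.
Proof.
apply: box_induction.
- by move=> S1 S2 E [L HL]; exists L => v; rewrite -E.
- by exists [::] => v; split=> // -[].
- move=> S1 S2 [L1 H1] [L2 H2]; exists (L1 ++ L2) => v; rewrite H1 H2; split.
    by case=> -[bp bpL Hbp]; exists bp; rewrite // mem_cat bpL ?orbT.
  by case=> bp; rewrite mem_cat => /orP[] bpL Hbp; [left|right]; exists bp.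
- move=> S1 i c HS x y z [Sx xc] [Sy yc] [Sz zc]; split; first exact: HS.
  by move: yc zc; rewrite !ffunE; lia.
- move=> S1 HS /(linear_upper_part HS)[x Sx [l Hl]]; exists x => //.
  exists [:: (x, l)] => v; rewrite Hl; split=> [H|[bp]]; first by exists (x, l); rewrite ?mem_head.
  by rewrite inE => /eqP->.
Qed.

End Slices.

(** * Words in a free group *)

(** Van der Waerden's construction: letters act on reduced words by permutations, which gives normal
    forms without a confluence argument. *)
Definition push a (s : seq nat) :=
  if s is b :: s' then if b == letter_inv a then s' else a :: s else [:: a].
Definition act u s := foldr push s u.
Definition red u := act u [::].
Definition reduced (s : seq nat) := sorted (fun a b => b != letter_inv a) s.

Lemma push_reduced a s : reduced s -> reduced (push a s).
Proof.
case: s => //= b s; case: ifP => [_|ba] sb; last by rewrite /= ba.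
exact: path_sorted sb.
Qed.

Lemma act_reduced u s : reduced s -> reduced (act u s).
Proof. by elim: u => //= a u IH /IH; apply: push_reduced. Qed.

Lemma pushK a s : reduced s -> push (letter_inv a) (push a s) = s.
Proof.
case: s => [|b s] /=; first by rewrite letter_invK eqxx.
have [->|_] := eqVneq b (letter_inv a); last by rewrite /= letter_invK eqxx.
by case: s => //= c s /andP[/negbTE-> _].
Qed.

Lemma act_push a r s : reduced s -> act (push a r) s = push a (act r s).
Proof.
case: r => //= b r rs; have [->|//] := eqVneq b (letter_inv a).
by have := pushK (letter_inv a) (act_reduced r rs); rewrite letter_invK.
Qed.

Lemma act_red u s : reduced s -> act (red u) s = act u s.
Proof. by elim: u => //= a u IH rs; rewrite act_push ?IH. Qed.

Lemma act_cat u v s : act (u ++ v) s = act u (act v s).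
Proof. exact: foldr_cat. Qed.

Lemma red_id s : reduced s -> red s = s.
Proof.
elim: s => //= a s IH rs; rewrite /red /= -/(red s) IH; last exact: path_sorted rs.
by case: s rs {IH} => //= b s /andP[/negbTE->].
Qed.

Lemma red_cat u v : red (u ++ v) = act u (red v).
Proof. exact: act_cat. Qed.

Definition word_inv u := rev (map letter_inv u).

Lemma act_word_invK u s : reduced s -> act (word_inv u) (act u s) = s.
Proof.
elim: u => //= a u IH rs; rewrite /word_inv /= rev_cons -cats1 act_cat /=.
by rewrite pushK ?IH ?act_reduced.
Qed.

Lemma word_invK : involutive word_inv.
Proof.
by move=> u; rewrite /word_inv map_rev revK -map_comp (eq_map letter_invK) map_id.
Qed.

(** A concrete free group on countably many generators, the target of homomorphisms defined on an
    abstract basis. *)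
Definition reduced_word := {s : seq nat | reduced s}.
HB.instance Definition _ := Choice.on reduced_word.

Definition rw_one : reduced_word := exist reduced [::] isT.
Definition rw_mul (x y : reduced_word) : reduced_word :=
  exist reduced (act (val x) (val y)) (act_reduced (val x) (valP y)).
Definition rw_inv (x : reduced_word) : reduced_word :=
  exist reduced (red (word_inv (val x))) (act_reduced (word_inv (val x)) (isT : reduced [::])).

Lemma rw_mulA : associative rw_mul.
Proof.
move=> x y z; apply: val_inj => /=.
rewrite -{2}(red_id (valP y)) -red_cat act_red ?(valP z) //.
by rewrite act_cat.
Qed.

Lemma rw_mul1 : left_id rw_one rw_mul.
Proof. by move=> x; apply: val_inj. Qed.

Lemma rw_mulr1 : right_id rw_one rw_mul.
Proof. by move=> x; apply: val_inj; apply: red_id (valP x). Qed.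

Lemma rw_mulV : left_inverse rw_one rw_inv rw_mul.
Proof.
move=> x; apply: val_inj => /=; rewrite act_red ?(valP x) //.
by rewrite -[X in act _ X](red_id (valP x)) act_word_invK.
Qed.

Lemma rw_mulrV : right_inverse rw_one rw_inv rw_mul.
Proof.
move=> x; apply: val_inj => /=.
by rewrite -[X in act X _]word_invK act_word_invK.
Qed.

HB.instance Definition _ := isGroup.Build reduced_word rw_mulA rw_mul1 rw_mulr1 rw_mulV rw_mulrV.

(** The first letter of the reduced form survives at some place of the word, and what precedes it
    there cancels completely. *)
Lemma dyck_factor u b r : red u = b :: r ->
  exists u1 u2, [/\ u = u1 ++ b :: u2, dyck u1 & red u2 = r].
Proof.
have [n] := ubnP (size u); elim: n u b r => // n IH [|a u] b r //= su.
rewrite /red /= -/(red u); case E: (red u) => [|c r'] /=.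
  by case=> <- <-; exists [::], u; split=> //; apply: dyck_nil.
have [cE Er|_ [<- <-]] := eqVneq c (letter_inv a); last first.
  by exists [::], u; split=> //; apply: dyck_nil.
rewrite cE in E; have [v1 [v2 [uE d1 Ev2]]] := IH _ _ _ su E.
have [|v3 [v4 [vE d3 Ev4]]] := IH v2 b r _ (etrans Ev2 Er).
  by move: su; rewrite uE size_cat /=; clear; lia.
exists (a :: v1 ++ letter_inv a :: v3), v4; split=> //; last exact: dyck_cons.
by rewrite uE vE /= -catA.
Qed.

Lemma dyck_of_red u : red u = [::] -> dyck u.
Proof.
have [n] := ubnP (size u); elim: n u => // n IH [|a u] su; first by move=> _; apply: dyck_nil.
rewrite /red /= -/(red u); case E: (red u) => [|c r] //=.
case: eqP => // cE rE; rewrite cE in E.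
have [v1 [v2 [uE d1 Ev2]]] := dyck_factor E.
rewrite uE; apply: dyck_cons => //; apply: IH; last by rewrite Ev2.
by move: su; rewrite uE /= size_cat /=; clear; lia.
Qed.

Section Evaluation.
Variables (F : groupType) (x : nat -> F).

Definition eval_letter a : F := if odd a then ((x a./2)^-1)%g else x a./2.
Definition eval_word u : F := (\prod_(a <- u) eval_letter a)%g.

Lemma eval_letter_inv a : eval_letter (letter_inv a) = ((eval_letter a)^-1)%g.
Proof.
rewrite /eval_letter /letter_inv; case oa: (odd a) => /=; rewrite ?oa /=.
  by case: a oa => //= a /negbTE oa; rewrite oa invgK uphalf_half oa.
by rewrite uphalf_half oa.
Qed.

Lemma eval_word_cat u v : eval_word (u ++ v) = (eval_word u * eval_word v)%g.
Proof. exact: big_cat. Qed.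

Lemma eval_word_cons a u : eval_word (a :: u) = (eval_letter a * eval_word u)%g.
Proof. exact: big_cons. Qed.

Lemma eval_word_nil : eval_word [::] = 1%g.
Proof. exact: big_nil. Qed.

Lemma eval_push a s : eval_word (push a s) = (eval_letter a * eval_word s)%g.
Proof.
case: s => [|b s] /=; first by rewrite eval_word_cons.
case: eqP => [->|_]; rewrite !eval_word_cons //.
by rewrite eval_letter_inv mulgA mulgV mul1g.
Qed.

Lemma eval_red u : eval_word (red u) = eval_word u.
Proof. by elim: u => //= a u IH; rewrite eval_word_cons /red /= eval_push IH. Qed.

Lemma eval_word_flatten (I : Type) (fw : I -> seq nat) (u : seq I) :
  eval_word (flatten (map fw u)) = (\prod_(i <- u) eval_word (fw i))%g.
Proof.
by elim: u => [|i u IH]; rewrite ?big_cons ?big_nil /= ?eval_word_cat ?IH // /eval_word big_nil.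
Qed.

End Evaluation.

(** * Generation of a free group by its basis *)

Section BasisGenerates.
Variables (F : groupType) (X : Type) (x : X -> F).

Definition signed_value (a : X * bool) : F := if a.2 then ((x a.1)^-1)%g else x a.1.
Definition signed_product (w : seq (X * bool)) : F := (\prod_(a <- w) signed_value a)%g.

Definition spanned : pred F :=
  fun y => excluded_middle_informative (exists w, y = signed_product w).

Lemma spannedP y : reflect (exists w, y = signed_product w) (y \in spanned).
Proof. by rewrite unfold_in /spanned; case: excluded_middle_informative => /= ?; constructor. Qed.

Lemma signed_cat v w : signed_product (v ++ w) = (signed_product v * signed_product w)%g.
Proof. exact: big_cat. Qed.

Lemma signed_inv w :
  ((signed_product w)^-1)%g = signed_product (rev [seq (a.1, ~~ a.2) | a <- w]).
Proof.
elim: w => [|[i b] w IH]; first by rewrite /signed_product !big_nil invg1.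
rewrite /= rev_cons -cats1 signed_cat -IH /signed_product big_cons big_seq1 invgM.
by case: b; rewrite /signed_value /= ?invgK.
Qed.

Lemma spanned_group : group_closed spanned.
Proof.
split; first by apply/spannedP; exists [::]; rewrite /signed_product big_nil.
move=> _ _ /spannedP[v ->] /spannedP[w ->]; apply/spannedP.
by exists (v ++ rev [seq (a.1, ~~ a.2) | a <- w]); rewrite signed_cat signed_inv.
Qed.

Definition span := {y : F | y \in spanned}.
HB.instance Definition _ := SubChoice.on span.
HB.instance Definition _ := SubChoice_isSubGroup.Build F spanned span spanned_group.

(** The universal property maps [F] into the subgroup spanned by the basis; followed by the
    inclusion this fixes the basis, so by uniqueness it is the identity. *)
Lemma basis_generates : free_basis x -> forall y, exists w, y = signed_product w.
Proof.
move=> xF y.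
have xs i : x i \in spanned.
  by apply/spannedP; exists [:: (i, false)]; rewrite /signed_product big_seq1.
have [phi [phix _]] := xF span (fun i => Sub (x i) (xs i)).
have [psi [_ psiU]] := xF F x.
pose incl : {multiplicative F -> F} := (val : span -> F) \o phi.
have Ey : y = psi y := psiU idfun (fun=> erefl) y.
have Epsi : incl y = psi y by apply: psiU => i /=; rewrite phix SubK.
by rewrite Ey -Epsi; apply/spannedP/valP.
Qed.

End BasisGenerates.

(** Numbers finitely many basis elements; the basis is a bare type, so equality is decided
    classically. *)
Lemma index_list (X : Type) (i0 : X) (l : seq X) :
  exists (nu : nat -> X) (ix : X -> nat), forall i, List.In i l -> nu (ix i) = i.
Proof.
elim: l => [|j l [nu [ix IH]]]; first by exists (fun=> i0), (fun=> 0).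
exists (fun n => if n is n'.+1 then nu n' else j).
exists (fun i => if excluded_middle_informative (i = j) then 0 else (ix i).+1).
by move=> i /= il; case: excluded_middle_informative => // ij; apply: IH; case: il => // /esym.
Qed.

(** Each [s i] is spelled in the finitely many basis elements involved. Evaluation of letters gives
    one direction; the other uses the homomorphism to [reduced_word] that the universal property
    provides. *)
Lemma free_group_words (F : groupType) k (s : 'I_k -> F) : free_group F ->
  exists fw : 'I_k -> seq nat, forall u v : seq 'I_k,
    word_value s u = word_value s v <->
    red (flatten (map fw u)) = red (flatten (map fw v)).
Proof.
case=> X [x xF].
have /choice[w Hw] := fun i => basis_generates xF (s i).
(* An empty basis makes [F] trivial; otherwise [i0] is the default element of the numbering. *)
have [[i0 _]|noX] := classic (exists i : X, True); last first.
  exists (fun=> [::]) => u v.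
  suff H y : word_value s y = 1%g.
    split=> _; last by rewrite !H.
    have E (z : seq 'I_k) : flatten [seq [::] | _ <- z] = [::] :> seq nat by elim: z.
    by rewrite !E.
  apply: big1 => i _; rewrite Hw; case: (w i) => [|[j b] l]; first exact: big_nil.
  by case: noX; exists j.
have [nu [ix Hix]] := index_list i0 [seq a.1 | a <- flatten (codom w)].
pose letter (a : X * bool) := (ix a.1).*2 + a.2.
pose fw i := map letter (w i).
exists fw => u v.
pose y n := x (nu n).
have inw i a : List.In a (w i) -> nu (ix a.1) = a.1.
  move=> aw; apply: Hix; apply: List.in_map.
  have : i \in enum 'I_k by rewrite mem_enum.
  rewrite codomE; elim: (enum 'I_k) => //= j e IH; rewrite inE => /orP[/eqP<-|ie].
    by apply/List.in_or_app; left.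
  by apply/List.in_or_app; right; apply: IH.
have fwE i : eval_word y (fw i) = s i.
  rewrite Hw /fw; have := inw i; elim: (w i) => [|[j b] l IH] Hl.
    by rewrite eval_word_nil /signed_product big_nil.
  rewrite /= eval_word_cons IH; last by move=> a al; apply: Hl; right.
  rewrite /signed_product big_cons; congr (_ * _)%g.
  have /= jE := Hl (j, b) (or_introl erefl).
  rewrite /eval_letter /letter /signed_value /= oddD odd_double /=.
  by case: b {Hl} => /=; rewrite /y ?addn0 ?addn1 /= ?uphalf_double ?doubleK jE.
have evE u' : eval_word y (flatten (map fw u')) = word_value s u'.
  by rewrite eval_word_flatten; apply: eq_bigr => i _.
split=> [E|E]; last by rewrite -!evE -(eval_red y) E eval_red.
have rl n : reduced [:: n] by [].
have [phi [phix _]] := xF reduced_word (fun i => exist reduced [:: (ix i).*2] (rl _)).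
have phiE u' : val (phi (word_value s u')) = red (flatten (map fw u')).
  have phi1 : phi 1%g = 1%g.
    by apply: (mulgI (phi 1%g)); rewrite -gmulfM !mulg1.
  have phiV z : phi (z^-1)%g = ((phi z)^-1)%g.
    by apply: (mulgI (phi z)); rewrite -gmulfM !mulgV.
  have phi_cat l z : val (phi (signed_product x l * z)%g) = act (map letter l) (val (phi z)).
    elim: l => [|[j b] l IH]; first by rewrite /signed_product big_nil mul1g.
    rewrite /signed_product big_cons -mulgA gmulfM /= -IH.
    rewrite /signed_value /letter; case: b => /=; rewrite ?phiV phix /= ?addn0 ?addn1.
      by rewrite /red /= /letter_inv odd_double.
    by [].
  elim: u' => [|i u' IH]; first by rewrite /word_value big_nil phi1.
  by rewrite /word_value big_cons Hw phi_cat IH /= red_cat.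
by rewrite -!phiE E.
Qed.

(** * The automaton reading free letters and vectors *)

Section IndexedPaths.
Variables (L : Type) (A : automaton (seq L)).

Definition edge i := nth (init A, [::], init A) (edges A) i.

Fixpoint apath (q : 'I_(nvert A)) (ns : seq nat) (r : 'I_(nvert A)) : bool :=
  if ns is i :: ns' then
    [&& i < size (edges A), (edge i).1.1 == q & apath (edge i).2 ns' r]
  else q == r.

Definition labels ns := flatten [seq (edge i).1.2 | i <- ns].

End IndexedPaths.

Lemma path_label_apath (N : monoidType) k (s : 'I_k -> N) (A : automaton (seq 'I_k)) p x q :
  @path_label N (relabel (word_value s) A) p x q <->
  exists ns, apath (p : 'I_(nvert A)) ns q /\ x = word_value s (labels A ns).
Proof.
have vcat u v : word_value s (u ++ v) = (word_value s u * word_value s v)%g by apply: big_cat.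
pose e0 : 'I_(nvert A) * seq 'I_k * 'I_(nvert A) := (init A, [::], init A).
split=> [|[ns [+ ->]]]; last first.
  elim: ns p => [|i ns IH] p /=.
    by move=> /eqP->; rewrite /word_value big_nil; apply: path_label_nil.
  case/and3P => iA /eqP<- pq; rewrite /labels /= vcat.
  apply: (@path_label_cons _ (relabel (word_value s) A) _ (edge A i).2); last exact: IH.
  apply/(nthP (init A, 1%g, init A)); exists i; first by rewrite size_map.
  by rewrite /= (nth_map e0).
elim=> [{}p|{}p r t y z pr _ [ns [pq ->]]].
  by exists [::]; rewrite /= eqxx /word_value big_nil.
have /(nthP (init A, 1%g, init A))[i] := pr; rewrite size_map => iA.
rewrite /= (nth_map e0) // => -[Ep Ey Er]; exists (i :: ns).
by rewrite /= iA /edge Ep Er eqxx /labels /= vcat Ey.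
Qed.

Lemma recognises_apath (N : monoidType) k (s : 'I_k -> N) (A : automaton (seq 'I_k)) (x : N) :
  recognises (relabel (word_value s) A) x <->
  exists ns q, [/\ q \in term A, apath (init A) ns q & x = word_value s (labels A ns)].
Proof.
split=> [[q qt /path_label_apath[ns [pq E]]]|[ns [q [qt pq E]]]]; first by exists ns, q.
by exists q => //; apply/path_label_apath; exists ns.
Qed.

Section Tracks.
Variables (k : nat) (fw : 'I_k -> seq nat) (A : automaton (seq 'I_k)).
Variables (winv : seq nat) (z0 zb : nat) (next : nat -> 'I_k -> nat).
Variables (vec : 'I_k -> nat -> int) (nl : nat) (lvec : nat -> nat -> int).
Hypotheses (z0b : z0 < zb) (nextb : forall z i, z < zb -> next z i < zb).

Definition atom := (nat + 'I_k)%type.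
Definition atom_letter (x : atom) : option nat := if x is inl a then Some a else None.
Definition atom_gen (x : atom) : option 'I_k := if x is inr i then Some i else None.
(** The mark [inr i] after the free letters of generator [i] is the place where its vector is
    counted and [next] is applied. *)
Definition expand (w : seq 'I_k) : seq atom :=
  flatten [seq rcons (map inl (fw i)) (inr i) | i <- w].

Lemma pmap_letter_expand w : pmap atom_letter (expand w) = flatten (map fw w).
Proof.
elim: w => //= i w IH; rewrite /expand /= pmap_cat -/(expand w) IH -cats1 pmap_cat cats0.
by rewrite map_pK.
Qed.

Lemma pmap_gen_expand w : pmap atom_gen (expand w) = w.
Proof.
elim: w => //= i w IH; rewrite /expand /= pmap_cat -/(expand w) IH -cats1 pmap_cat /=.
by elim: (fw i).
Qed.

(* Track [0] spells [winv]; track [i.+1] spells the label of edge [i]. *)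
Definition track t : seq atom := if t is i.+1 then expand (edge A i).1.2 else map inl winv.
Definition track_end t : 'I_(nvert A) := if t is i.+1 then (edge A i).2 else init A.

(** Track, position on the track, and state of the automaton given by [next]. The last entry of an
    edge is 0 for a move and [l.+1] for loop [l], which is available at the start state only. *)
Definition state := (nat * nat * nat)%type.
Definition bedge := (state * state * nat)%type.
Definition bsrc (e : bedge) := e.1.1.
Definition bdst (e : bedge) := e.1.2.

Definition atom_at t p : option atom := onth (track t) p.

Definition atom_step z (x : atom) := if x is inr i then next z i else z.

Definition bvalid (e : bedge) : bool :=
  let: ((t, p, z), (t', p', z'), j) := e in
  [&& z < zb, z' < zb, t <= size (edges A) &
  if j is l.+1 then [&& l < nl, (t, p, z) == (0, 0, z0) & (t', p', z') == (0, 0, z0)]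
  else if atom_at t p is Some x then
    [&& t' == t, p' == p.+1 & z' == atom_step z x]
  else [&& p == size (track t), 0 < t' <= size (edges A),
           (edge A t'.-1).1.1 == track_end t, p' == 0 & z' == z]].

Definition bletter (e : bedge) : option nat :=
  if e.2 is 0 then obind atom_letter (atom_at e.1.1.1.1 e.1.1.1.2) else None.

Definition bweight i (e : bedge) : int :=
  if e.2 is l.+1 then lvec l i
  else if obind atom_gen (atom_at e.1.1.1.1 e.1.1.1.2) is Some g then vec g i else 0%R.

Definition run := foldl next.

Lemma atom_at_some t p x : atom_at t p = Some x ->
  drop p (track t) = x :: drop p.+1 (track t).
Proof.
rewrite /atom_at; elim: (track t) p => [|y s IH] [|p] //=; last exact: IH.
by case=> ->; rewrite drop0.
Qed.

Lemma atom_at_none t p : atom_at t p = None -> drop p (track t) = [::].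
Proof. by rewrite /atom_at; elim: (track t) p => [|y s IH] [|p] //=; apply: IH. Qed.

Lemma atom_at_size t p : atom_at t p = None -> p <= size (track t) -> p = size (track t).
Proof.
move/atom_at_none/(congr1 size); rewrite size_drop /= => /eqP.
by rewrite subn_eq0 => ps sp; apply/eqP; rewrite eqn_leq ps sp.
Qed.

Notation bpath := (epath bsrc bdst).
Notation bletters := (pmap bletter).

Definition gens_weight w i : int := (\sum_(g <- w) vec g i)%R.
Definition loops_weight ls i : int := (\sum_(l <- ls) lvec l i)%R.

Definition gens_from t p := pmap atom_gen (drop p (track t)).
Definition letters_from t p := pmap atom_letter (drop p (track t)).

(** Stated from the middle of a track, whose remainder is accounted for by [gens_from] and
    [letters_from], so that the induction can proceed by single moves. *)
Lemma apath_of_bpath es t p z t' z' :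
  all bvalid es -> p <= size (track t) -> bpath (t, p, z) es (t', size (track t'), z') ->
  exists ns ls, [/\ apath (track_end t) ns (track_end t'), size ns <= size es,
    bletters es = letters_from t p ++ flatten (map fw (labels A ns)),
    z' = run z (gens_from t p ++ labels A ns) &
    all (gtn nl) ls /\ forall i, (\sum_(e <- es) bweight i e =
       gens_weight (gens_from t p ++ labels A ns) i + loops_weight ls i)%R].
Proof.
rewrite /gens_from /letters_from /gens_weight /loops_weight.
elim: es t p z => [|[[[[t1 p1] z1] [[t2 p2] z2]] j] es IH] t p z.
  move=> _ _ /eqP[-> -> ->]; exists [::], [::]; rewrite drop_size /= eqxx; split=> //.
  by split=> // i; rewrite !big_nil.
rewrite /bsrc /bdst /= => /andP[/and4P[_ _ _ ve] vs] ps /andP[/eqP[? ? ?] pe]; subst t1 p1 z1.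
case: j ve => [|l] ve; last first.
  case/and3P: ve => lnl /eqP[? ? ?] /eqP[? ? ?]; subst t p z t2 p2 z2.
  have [ns [ls [pn sn En zE [als wE]]]] := IH _ _ _ vs ps pe.
  exists ns, (l :: ls); split=> //=; first exact: leqW.
  split=> [|i]; first by rewrite lnl als.
  by rewrite !big_cons wE /bweight /= addrCA.
case E: (atom_at t p) ve => [x|] /=.
  case/and3P => /eqP? /eqP? /eqP?; subst t2 p2 z2.
  have Ed := atom_at_some E.
  have ps' : p < size (track t).
    by rewrite ltnNge; apply/negP => /drop_oversize; rewrite Ed.
  have [ns [ls [pn sn En zE [als wE]]]] := IH _ _ _ vs ps' pe.
  exists ns, ls; rewrite Ed; split=> //; first exact: leqW.
  - by rewrite /= [bletter (_, 0)]/bletter /= E En; case: x {E Ed zE pe}.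
  - by move: zE; case: (x).
  - split=> // i; rewrite big_cons wE /bweight /= E.
    case: x {E Ed zE pe} => [a|g] /=; first by rewrite add0r.
    by rewrite big_cons addrA.
case/and5P => /eqP pE /andP[t20 t2s] /eqP sE /eqP? /eqP?; subst p p2 z2.
case: t2 t20 t2s sE pe => // t2 _ t2s /= sE pe.
have [|ns [ls [pn sn En zE [als wE]]]] := IH _ _ _ vs _ pe; first by [].
exists (t2 :: ns), ls; rewrite drop_size /=; split=> //.
- by rewrite t2s sE eqxx.
- rewrite [bletter (_, 0)]/bletter /= E En /letters_from drop0 /= pmap_letter_expand.
  by rewrite /labels /= map_cat flatten_cat.
- by rewrite zE drop0 /= pmap_gen_expand.
- split=> // i; rewrite big_cons wE [bweight i (_, 0)]/bweight /= E add0r drop0 /= pmap_gen_expand.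
  by rewrite /labels.
Qed.

Lemma track_bpath t p z : t <= size (edges A) -> z < zb -> p <= size (track t) -> exists es,
  [/\ all bvalid es, bpath (t, p, z) es (t, size (track t), run z (gens_from t p)),
    bletters es = letters_from t p &
    forall i, (\sum_(e <- es) bweight i e = gens_weight (gens_from t p) i)%R].
Proof.
rewrite /gens_from /letters_from /gens_weight => tA.
have [n] := ubnP (size (track t) - p); elim: n p z => // n IH p z np zz ps.
case E: (atom_at t p) => [x|]; last first.
  exists [::]; rewrite (atom_at_none E) /= -(atom_at_size E ps) eqxx; split=> //.
  by move=> i; rewrite !big_nil.
have Ed := atom_at_some E.
have ps' : p < size (track t).
  by rewrite ltnNge; apply/negP => /drop_oversize; rewrite Ed.
have zx : atom_step z x < zb by case: (x) => //= g; apply: nextb.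
have [|es [ves pes les wes]] := IH p.+1 (atom_step z x) _ zx ps'; first by lia.
exists (((t, p, z), (t, p.+1, atom_step z x), 0) :: es); rewrite Ed; split.
- by rewrite /= E zz zx tA !eqxx.
- by rewrite /= eqxx /=; case: x {E Ed zx} pes.
- by rewrite /= [bletter (_, 0)]/bletter /= E les; case: x {E Ed zx les pes wes}.
- move=> i; rewrite big_cons wes /bweight /= E.
  by case: x {E Ed zx pes les wes} => [a|g] /=; rewrite ?add0r ?big_cons.
Qed.

Lemma bpath_of_apath ns t z q : t <= size (edges A) -> z < zb ->
  apath (track_end t) ns q -> exists es t',
  [/\ all bvalid es, track_end t' = q,
    bpath (t, size (track t), z) es (t', size (track t'), run z (labels A ns)),
    bletters es = flatten (map fw (labels A ns)) &
    forall i, (\sum_(e <- es) bweight i e = gens_weight (labels A ns) i)%R].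
Proof.
elim: ns t z => [|j ns IH] t z tA zz /=.
  move=> /eqP tq; exists [::], t; split; rewrite /= ?eqxx // => i.
  by rewrite /gens_weight !big_nil.
case/and3P => jA /eqP jt pq.
have [es1 [v1 p1 l1 w1]] := @track_bpath j.+1 0 z jA zz (leq0n _).
have rb w z' : z' < zb -> run z' w < zb.
  by elim: w z' => //= g w IHw z' /(nextb g)/IHw.
have [|es2 [t' [v2 t'q p2 l2 w2]]] := IH j.+1 (run z (gens_from j.+1 0)) jA _ pq; first exact: rb.
exists (((t, size (track t), z), (j.+1, 0, z), 0) :: es1 ++ es2), t'.
have aN : atom_at t (size (track t)) = None by rewrite /atom_at; elim: (track t).
have gE : gens_from j.+1 0 = (edge A j).1.2 by rewrite /gens_from drop0 pmap_gen_expand.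
have lE : letters_from j.+1 0 = flatten (map fw (edge A j).1.2).
  by rewrite /letters_from drop0 pmap_letter_expand.
have lab : labels A (j :: ns) = (edge A j).1.2 ++ labels A ns by [].
split=> //.
- by rewrite /= aN all_cat v1 v2 zz tA /= jA jt !eqxx.
- rewrite lab /= eqxx /=; apply: cat_epath p1 _.
  by rewrite /run foldl_cat -gE.
- by rewrite /= [bletter (_, 0)]/bletter /= aN pmap_cat l1 l2 lE lab map_cat flatten_cat.
- move=> i; rewrite big_cons big_cat /= w1 w2 /bweight /= aN add0r gE lab.
  by rewrite /gens_weight big_cat.
Qed.

(** An edge consists of seven numbers, so at most [c ^ 7] distinct edges have all entries below
    [c]. *)
Definition box c : seq bedge :=
  let cube := [seq (tp, z) | tp <- [seq (t, p) | t <- iota 0 c, p <- iota 0 c], z <- iota 0 c] in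
  [seq (xy, j) | xy <- [seq (x, y) | x <- cube, y <- cube], j <- iota 0 c].

Lemma size_box c : size (box c) = c ^ 7.
Proof. by rewrite !size_allpairs !size_iota !expnS expn0 muln1 !mulnA. Qed.

Lemma mem_box c t p z t' p' z' j :
  [&& t < c, p < c, z < c, t' < c, p' < c, z' < c & j < c] ->
  (t, p, z, (t', p', z'), j) \in box c.
Proof.
move=> /and5P[ht hp hz ht' /and3P[hp' hz' hj]].
by rewrite !allpairs_f // mem_iota.
Qed.

(** The data become one path that takes the loops [ls], spells [winv] and then follows [ns]; it is
    shortened by [short_dyck_path]. The value of [run] is kept, being a component of the end
    state. *)
Theorem short_apath c d (kappa : nat -> int) ns ls q :
  size (edges A) < c -> (forall t, t <= size (edges A) -> size (track t) < c) ->
  zb <= c -> nl < c ->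
  (forall g i, i < d -> bounded c (vec g i)) ->
  (forall l i, l < nl -> i < d -> bounded c (lvec l i)) ->
  (forall i, i < d -> bounded c (kappa i)) ->
  apath (init A) ns q -> dyck (winv ++ flatten (map fw (labels A ns))) ->
  all (gtn nl) ls ->
  (forall i, i < d -> (gens_weight (labels A ns) i + loops_weight ls i = kappa i)%R) ->
  exists ns' ls', [/\ apath (init A) ns' q /\ size ns' <= path_bound (c ^ 7) d c,
    dyck (winv ++ flatten (map fw (labels A ns'))),
    run z0 (labels A ns') = run z0 (labels A ns),
    all (gtn nl) ls' &
    forall i, i < d -> (gens_weight (labels A ns') i + loops_weight ls' i = kappa i)%R].
Proof.
move=> Ac trc zc nlc vecb lvecb kb pq dy lsn wE.
pose es0 : seq bedge := [seq ((0, 0, z0), (0, 0, z0), l.+1) | l <- ls].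
have [es1 [v1 p1 l1 w1]] := @track_bpath 0 0 z0 (leq0n _) z0b (leq0n _).
have g0 : gens_from 0 0 = [::] by rewrite /gens_from drop0 /=; elim: winv.
rewrite g0 /= in p1 w1.
have le0 : letters_from 0 0 = winv by rewrite /letters_from drop0 /= map_pK.
rewrite le0 in l1.
have [es2 [t' [v2 t'q p2 l2 w2]]] := @bpath_of_apath ns 0 z0 q (leq0n _) z0b pq.
have p0 : bpath (0, 0, z0) es0 (0, 0, z0).
  by rewrite /es0; elim: (ls) => //= l ls' ->; rewrite /bsrc /= eqxx.
have l0 : bletters es0 = [::] by rewrite /es0; elim: (ls).
have w0 i : (\sum_(e <- es0) bweight i e = loops_weight ls i)%R.
  by rewrite /es0 big_map; apply: eq_bigr.
have v0 : all bvalid es0.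
  by apply/allP => _ /mapP[l /(allP lsn) /= lnl ->] /=; rewrite z0b lnl !eqxx.
pose es := es0 ++ es1 ++ es2.
have pe : bpath (0, 0, z0) es (t', size (track t'), run z0 (labels A ns)).
  exact: cat_epath p0 (cat_epath p1 p2).
have le : bletters es = winv ++ flatten (map fw (labels A ns)).
  by rewrite !pmap_cat l0 l1 l2.
have we i : i < d -> (\sum_(e <- es) bweight i e = kappa i)%R.
  move=> /wE <-; rewrite !big_cat /= w0 w1 w2 /gens_weight big_nil add0r; exact: addrC.
have ve : all bvalid es by rewrite !all_cat v0 v1 v2.
have [es' [pe' de' se' sze' we']] :
    exists es', [/\ bpath (0, 0, z0) es' (t', size (track t'), run z0 (labels A ns)),
      dyck (bletters es'), {subset es' <= es}, size es' <= path_bound (c ^ 7) d c &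
      forall i, i < d -> (\sum_(e <- es') bweight i e = \sum_(e <- es) bweight i e)%R].
  apply: short_dyck_path => //; first by rewrite le.
  - rewrite -size_box; apply: uniq_leq_size; first exact: undup_uniq.
    move=> [[[[t p] z] [[t1 p1'] z1]] j]; rewrite mem_undup => /(allP ve) /and4P[zz z1z tA].
    have c0 : 0 < c by apply: leq_trans Ac.
    case: j => [|l]; last first.
      case/and3P => lnl /eqP[-> -> ->] /eqP[-> -> ->]; apply: mem_box.
      by rewrite c0 (leq_trans z0b zc) (leq_ltn_trans lnl nlc).
    have tc : t < c by apply: leq_ltn_trans Ac.
    case E: (atom_at t p) => [x|].
      case/and3P => /eqP-> /eqP-> _; apply: mem_box.
      have ps : p < size (track t) by rewrite -onthTE; move: E; rewrite /atom_at => ->.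
      have ptc := leq_ltn_trans ps (trc t tA).
      by rewrite tc ptc (ltnW ptc) c0 !(leq_trans _ zc).
    case/and5P => /eqP-> /andP[_ t1A] _ /eqP-> _; apply: mem_box.
    by rewrite tc (trc t tA) (leq_trans zz zc) (leq_ltn_trans t1A Ac) c0 (leq_trans z1z zc).
  - move=> i e id /(allP ve); case: e => [[[[t p] z] [[t1 p1'] z1]] [|l]] /and4P[_ _ _].
      by rewrite /bweight /=; case: obind => [g|] _; [apply: vecb | rewrite /bounded normr0].
    by case/and3P => lnl _ _; apply: lvecb.
  - by move=> i id; rewrite we //; apply: kb.
have [|//|ns' [ls' [pn' sn' En zE [als wE']]]] := apath_of_bpath _ _ pe'.
  by apply/allP => e /se'; apply: (allP ve).
exists ns', ls'; rewrite /= g0 in zE wE'; split=> //.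
- by rewrite -t'q; split=> //; apply: leq_trans sze'.
- by rewrite -le0 -En.
- by move=> i id; rewrite -wE' we' // we.
Qed.

End Tracks.

(** * The decision procedure *)

Lemma recursive_of_rec n f : rec f -> recursive (fun t : n.-tuple nat => f t).
Proof.
case=> k [g [rg fg]].
apply: (@recursive_ext _ (fun t : n.-tuple nat => g [tuple nth 0 t i | i < k])).
  by move=> t; rewrite fg.
apply: recursive_comp rg _ => i; have [ni|ni] := leqP n i.
  have H0 := @recursive_comp n 0 (fun=> 0) (fun _ _ => 0) recursive_zero.
  apply: recursive_ext (H0 _) => [t|[]//].
  by rewrite nth_default ?size_tuple.
apply: (@recursive_ext _ (fun t : n.-tuple nat => tnth t (Ordinal ni))).
  by move=> t; rewrite (tnth_nth 0).
exact: recursive_proj.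
Qed.

Lemma rec2_block_bound : rec2 block_bound.
Proof.
have := rec_iteri3 (N := fun e => nth 0 e 1) (h := fun _ r q => r * (q * r).*2.+1)
  (z := fun=> 1) (p := fun e => nth 0 e 0) (rec_var 1) _ (rec_const 1) (rec_var 0).
move=> H; apply: rec_ext (H _).
  by move=> e; elim: (nth 0 e 1) => //= D ->.
apply: rec_app2 rec2_mul (rec_var 1) _.
apply: rec_ext (rec_succ (rec_app2 rec2_mul (rec_const 2)
  (rec_app2 rec2_mul (rec_var 2) (rec_var 1)))) => e.
by rewrite mul2n.
Qed.

Lemma rec_path_bound n d c : rec n -> rec d -> rec c ->
  rec (fun e => path_bound (n e) (d e) (c e)).
Proof.
move=> rn rd rc.
have rs : rec (fun e => 2 * n e + 2).
  exact: rec_app2 rec2_add (rec_app2 rec2_mul (rec_const 2) rn) (rec_const 2).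
have rm : rec (fun e => rule_count (n e)).
  exact: rec_app2 rec2_add (rec_app2 rec2_add rs (rec_app2 rec2_mul rn rs))
    (rec_app2 rec2_mul (rec_app2 rec2_mul rn rn) rs).
have rC : rec (fun e => (2 * rule_count (n e) + 2) * (c e + 1)).
  exact: rec_app2 rec2_mul (rec_app2 rec2_add (rec_app2 rec2_mul (rec_const 2) rm) (rec_const 2))
    (rec_app2 rec2_add rc (rec_const 1)).
have rB := rec_app2 rec2_block_bound rC (rec_app2 rec2_add (rec_app2 rec2_mul rs rs) rd).
exact: rec_app2 rec2_mul (rec_const 2) (rec_app2 rec2_add rm rB).
Qed.

(** * Testing coded paths in coded automata *)

Section CodedPaths.
Local Notation decode := CodeSeq.decode.

Definition coded_edges a := decode (nth 0 (decode a) 3).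
Definition coded_edge a i := decode (nth 0 (coded_edges a) i).
Definition coded_terms a := decode (nth 0 (decode a) 2).

(** A path is read from its end; the accumulator is the current vertex plus one, and 0 after a
    mismatch. *)
Definition chain_step i r a :=
  if (i < size (coded_edges a)) && (r == (nth 0 (coded_edge a i) 2).+1)
  then (nth 0 (coded_edge a i) 0).+1 else 0.
Definition coded_chain a ns q := foldr (fun i r => chain_step i r a) q.+1 ns.
Definition coded_labels a ns :=
  foldr (fun i r => decode (nth 0 (coded_edge a i) 1) ++ r) [::] ns.

Definition coded_accept a ns :=
  has (fun j => coded_chain a ns (nth 0 (coded_terms a) j) == (nth 0 (decode a) 1).+1)
    (iota 0 (size (coded_terms a))).

Lemma recl_coded_edges a : rec a -> recl (fun e => coded_edges (a e)).
Proof. by move=> ra; apply: recl_decode (rec_nth (recl_decode ra) (rec_const 3)). Qed.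

Lemma recl_coded_edge a i : rec a -> rec i -> recl (fun e => coded_edge (a e) (i e)).
Proof. by move=> ra ri; apply: recl_decode (rec_nth (recl_coded_edges ra) ri). Qed.

Lemma recl_coded_terms a : rec a -> recl (fun e => coded_terms (a e)).
Proof. by move=> ra; apply: recl_decode (rec_nth (recl_decode ra) (rec_const 2)). Qed.

Lemma rec3_chain_step : rec3 chain_step.
Proof.
apply: rec_if (rec_const 0).
  apply: recb_and; first exact: recb_ltn (rec_var 0) (rec_size (recl_coded_edges (rec_var 2))).
  apply: recb_eq (rec_var 1) (rec_succ (rec_nth _ (rec_const 2))).
  exact: recl_coded_edge (rec_var 2) (rec_var 0).
by apply: rec_succ (rec_nth _ (rec_const 0)); apply: recl_coded_edge (rec_var 2) (rec_var 0).
Qed.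

Lemma recl_coded_labels a ns : rec a -> recl ns -> recl (fun e => coded_labels (a e) (ns e)).
Proof.
move=> ra rns.
apply: (recl_foldr (h := fun i r a => decode (nth 0 (coded_edge a i) 1) ++ r)) recl_nil rns ra.
apply: recl_cat (recl_decode (rec_var 1)); apply: recl_decode (rec_nth _ (rec_const 1)).
exact: recl_coded_edge (rec_var 2) (rec_var 0).
Qed.

Lemma recb_coded_accept : recb (fun e => coded_accept (nth 0 e 0) (decode (nth 0 e 1))).
Proof.
apply: (@recb_has (fun e => size (coded_terms (nth 0 e 0)))
  (fun e => coded_chain (nth 0 e 1) (decode (nth 0 e 2))
      (nth 0 (coded_terms (nth 0 e 1)) (nth 0 e 0))
    == (nth 0 (decode (nth 0 e 1)) 1).+1)).
  exact: rec_size (recl_coded_terms (rec_var 0)).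
apply: recb_eq; last exact: rec_succ (rec_nth (recl_decode (rec_var 1)) (rec_const 1)).
apply: rec_foldr rec3_chain_step _ (recl_decode (rec_var 2)) (rec_var 1).
exact: rec_succ (rec_nth (recl_coded_terms (rec_var 1)) (rec_var 0)).
Qed.

Section Automaton.
Variables (k : nat) (A : automaton (seq 'I_k)).
Local Notation a := (automaton_code A).

Lemma coded_edgesE : coded_edges a =
  [seq CodeSeq.code [:: val e.1.1; word_code e.1.2; val e.2] | e <- edges A].
Proof. by rewrite /coded_edges /automaton_code !CodeSeq.codeK. Qed.

Lemma coded_edgeE i : i < size (edges A) ->
  coded_edge a i = [:: val (edge A i).1.1; word_code (edge A i).1.2; val (edge A i).2].
Proof.
move=> iA; rewrite /coded_edge coded_edgesE.
by rewrite (nth_map (init A, [::], init A)) // CodeSeq.codeK.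
Qed.

Lemma coded_chainE (p q : 'I_(nvert A)) ns :
  (coded_chain a ns (val q) == (val p).+1) = apath p ns q.
Proof.
elim: ns p => [|i ns IH] p /=; first by rewrite eqSS eq_sym.
rewrite /chain_step coded_edgesE size_map -/(coded_chain a ns (val q)).
case: ltnP => //= iA; rewrite coded_edgeE //= IH.
by case: (apath (edge A i).2 ns q) => //=; rewrite ?andbT ?andbF // eqSS.
Qed.

Lemma coded_labelsE ns (p q : 'I_(nvert A)) : apath p ns q ->
  coded_labels a ns = [seq val i | i <- labels A ns].
Proof.
elim: ns p => //= i ns IH p /and3P[iA _ /IH ->].
by rewrite coded_edgeE //= CodeSeq.codeK /labels /= map_cat.
Qed.

Lemma coded_acceptE ns :
  coded_accept a ns <-> exists2 q, q \in term A & apath (init A) ns q.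
Proof.
have tE : coded_terms a = [seq val q | q <- enum (term A)].
  by rewrite /coded_terms /automaton_code !CodeSeq.codeK.
have iE : nth 0 (decode a) 1 = val (init A) by rewrite /automaton_code CodeSeq.codeK.
rewrite /coded_accept tE iE; split.
  case/hasP => j; rewrite mem_iota size_map /= => js.
  rewrite (nth_map (init A)) // coded_chainE => pq.
  by exists (nth (init A) (enum (term A)) j) => //; rewrite -mem_enum mem_nth.
case=> q qt pq; have qe : q \in enum (term A) by rewrite mem_enum.
apply/hasP; exists (index q (enum (term A))).
  by rewrite mem_iota size_map index_mem.
by rewrite (nth_map (init A)) ?index_mem // nth_index // coded_chainE.
Qed.

End Automaton.

(** Turns the search over short lists of edge indices into a search over the numbers below a
    bound. *)
Lemma code_bound m s : all (fun i => i <= m) s -> CodeSeq.code s < 2 ^ (m.+1 * size s).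
Proof.
elim: s => [|i s IH] /=; first by rewrite muln0.
move=> /andP[im /IH lt].
rewrite (mulnS m.+1) expnD expnS -mulnA mulnCA.
apply: leq_trans (_ : 2 ^ i * (2 * 2 ^ (m.+1 * size s)) <= _).
  by rewrite ltn_pmul2l ?expn_gt0 // -mul2n; lia.
by rewrite leq_mul2r leq_exp2l // im orbT.
Qed.

Lemma mem_leq_code i s : i \in s -> i < CodeSeq.code s.
Proof. by move/(allP (CodeSeq.ltn_code s)). Qed.

Lemma size_leq_code s : size s <= CodeSeq.code s.
Proof.
elim: s => //= i s IH; have : 0 < 2 ^ i by rewrite expn_gt0.
by move: (2 ^ i) => x; rewrite -addnn; nia.
Qed.

Lemma edges_leq_code k (A : automaton (seq 'I_k)) : size (edges A) < automaton_code A.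
Proof.
apply: leq_ltn_trans (_ : CodeSeq.code
  [seq CodeSeq.code [:: val e.1.1; word_code e.1.2; val e.2] | e <- edges A] < _).
  by rewrite -[leqLHS](size_map (fun e =>
    CodeSeq.code [:: val e.1.1; word_code e.1.2; val e.2])) size_leq_code.
by apply: mem_leq_code; rewrite !inE eqxx !orbT.
Qed.

Lemma label_leq_code k (A : automaton (seq 'I_k)) i :
  size (edge A i).1.2 <= automaton_code A.
Proof.
have [iA|iA] := ltnP i (size (edges A)); last by rewrite /edge nth_default.
have eA : edge A i \in edges A by apply: mem_nth.
rewrite -[size _](size_map val); apply: leq_trans (size_leq_code _) _.
apply: ltnW; apply: ltn_trans (_ : CodeSeq.code [seq CodeSeq.code
    [:: val e.1.1; word_code e.1.2; val e.2] | e <- edges A] < _); last first.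
  by apply: mem_leq_code; rewrite !inE eqxx !orbT.
apply: ltn_trans (mem_leq_code (map_f _ eA)).
by apply: mem_leq_code; rewrite !inE eqxx !orbT.
Qed.

End CodedPaths.

(** The algorithm tries every code of a list of edge indices below a bound derived from [H], testing
    that it is an accepted path and that its label has the value of [w]. *)
Theorem decidable_of_path_bound (N : monoidType) k (s : 'I_k -> N)
    (wp : seq nat -> seq nat -> bool) (H : nat -> nat -> nat) :
  recb (fun e => wp (CodeSeq.decode (nth 0 e 0)) (CodeSeq.decode (nth 0 e 1))) ->
  (forall u w : seq 'I_k, wp (map val u) (map val w) <-> word_value s u = word_value s w) ->
  rec2 H ->
  (forall (A : automaton (seq 'I_k)) ns q (w : seq 'I_k), apath (init A) ns q ->
    word_value s (labels A ns) = word_value s w ->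
    exists ns', [/\ apath (init A) ns' q, size ns' <= H (automaton_code A) (word_code w) &
      word_value s (labels A ns') = word_value s w]) ->
  exists2 f, recursive f & rational_subset_decider s f.
Proof.
move=> rwp wpE rH short.
pose test p a w := coded_accept a (CodeSeq.decode p) &&
  wp (coded_labels a (CodeSeq.decode p)) (CodeSeq.decode w).
pose bound a w := 2 ^ (a.+1 * H a w).
pose g (e : seq nat) : nat :=
  has (fun p => test p (nth 0 e 0) (nth 0 e 1)) (iota 0 (bound (nth 0 e 0) (nth 0 e 1))).
have rg : rec g.
  apply: (@recb_has (fun e => bound (nth 0 e 0) (nth 0 e 1))
    (fun e => test (nth 0 e 0) (nth 0 e 1) (nth 0 e 2))).
    apply: rec_app2 rec2_exp (rec_const 2) (rec_app2 rec2_mul (rec_succ (rec_var 0)) _).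
    exact: rH.
  apply: recb_and.
    exact: (rec_app2 (f := fun a p => coded_accept a (CodeSeq.decode p)) recb_coded_accept
      (rec_var 1) (rec_var 0)).
  have := rec_app2 (f := fun u w => wp (CodeSeq.decode u) (CodeSeq.decode w)) rwp
    (recl_coded_labels (rec_var 1) (recl_decode (rec_var 0))) (rec_var 2).
  by apply: rec_ext => e; rewrite CodeSeq.codeK.
exists (fun t => g t); first exact: recursive_of_rec.
move=> A w; rewrite recognises_apath /=.
set a := automaton_code A.
have wK : CodeSeq.decode (word_code w) = map val w by apply: CodeSeq.codeK.
rewrite /g; split.
  case E: (has _ _) => // _; have /hasP[p _ /andP[/coded_acceptE[q qt pq]]] := E.
  by rewrite (coded_labelsE pq) wK => /wpE Ew; exists (CodeSeq.decode p), q.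
case=> ns [q [qt pq /esym Ew]].
have [ns' [pq' sns' Ew']] := short A ns q w pq Ew.
suff -> : has (fun p => test p a (word_code w)) (iota 0 (bound a (word_code w))) by [].
apply/hasP; exists (CodeSeq.code ns').
  rewrite mem_iota /=; apply: leq_trans (code_bound (m := a) _) _; last first.
    by rewrite leq_exp2l // leq_mul2l sns' orbT.
  (* Edge indices are less than the number of edges, which is less than the code of the
     automaton. *)
  apply/allP => i ins; apply: ltnW; apply: ltn_trans (edges_leq_code A).
  elim: ns' (init A) pq' ins {sns' Ew'} => //= j ns' IH p /and3P[jA _ /IH jns].
  by rewrite inE => /orP[/eqP->|/jns].
apply/andP; rewrite CodeSeq.codeK; split; first by apply/coded_acceptE; exists q.
by rewrite (coded_labelsE pq') wK; apply/wpE.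
Qed.

(** * Products with a free group *)

Lemma dyck_act v s : dyck v -> reduced s -> act v s = s.
Proof.
move=> dv; elim: dv s => // a u w _ IHu _ IHw s rs.
rewrite /= act_cat /= IHw // IHu ?push_reduced //.
by rewrite -{1}(letter_invK a) pushK.
Qed.

Lemma dyck_quotient u w : dyck (word_inv w ++ u) <-> red u = red w.
Proof.
split=> [d|E]; last first.
  by apply: dyck_of_red; rewrite red_cat E act_word_invK.
have ru : reduced (red u) by apply: act_reduced.
rewrite -[red u](act_word_invK (word_inv w)) // word_invK -red_cat /red.
by rewrite (dyck_act d).
Qed.

Section Product.
Variables (F : groupType) (M : monoidType) (k : nat) (s : 'I_k -> (F * M)%type).

Lemma word_value_pair u :
  word_value s u = (word_value (fun i => (s i).1) u, word_value (fun i => (s i).2) u).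
Proof.
elim: u => [|i u IH]; first by rewrite /word_value !big_nil.
by rewrite /word_value !big_cons -!/(word_value _ _) IH.
Qed.

End Product.

(* For every target word [w], the words with the same value as [w] are recognised, with at
   most [k0 * (size w + 1)] states, by deterministic automata [next] whose letters and loops
   carry vectors of bounded entries that have to sum up to [kappa]. *)
Definition vector_acceptable (M : monoidType) k (m : 'I_k -> M) := exists d k0 : nat,
  forall u w, word_value m u = word_value m w ->
  exists (z0 zb : nat) (next : nat -> 'I_k -> nat) (vec : 'I_k -> nat -> int)
      (nl : nat) (lvec : nat -> nat -> int) (kappa : nat -> int) (ls : seq nat),
    let c := k0 * (size w + 1) in
    [/\ z0 < zb <= c /\ nl < c, forall z i, z < zb -> next z i < zb,
      [/\ forall g i, i < d -> bounded c (vec g i),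
         forall l i, l < nl -> i < d -> bounded c (lvec l i) &
         forall i, i < d -> bounded c (kappa i)],
      all (gtn nl) ls /\ (forall i, i < d ->
        (gens_weight vec u i + loops_weight lvec ls i = kappa i)%R) &
      forall u' ls', run next z0 u' = run next z0 u -> all (gtn nl) ls' ->
        (forall i, i < d ->
          (gens_weight vec u' i + loops_weight lvec ls' i = kappa i)%R) ->
        word_value m u' = word_value m w].

(** Continuation by the empty list, which has finite support and is therefore recursive. *)
Definition extend_ord k (f : 'I_k -> seq nat) (n : nat) : seq nat :=
  oapp f [::] (insub n).

Lemma extend_ord_val k (f : 'I_k -> seq nat) i : extend_ord f (val i) = f i.
Proof. by rewrite /extend_ord valK. Qed.

Lemma extend_ord_support k (f : 'I_k -> seq nat) :
  exists n, forall m, n <= m -> extend_ord f m = [::].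
Proof. by exists k => m km; rewrite /extend_ord insubN // -leqNgt. Qed.

Lemma flatten_extend_ord k (f : 'I_k -> seq nat) u :
  flatten (map (extend_ord f) (map val u)) = flatten (map f u).
Proof. by rewrite -map_comp; congr flatten; apply: eq_map => i; apply: extend_ord_val. Qed.

Lemma rec_odd a : rec a -> rec (fun e => odd (a e)).
Proof.
move=> ra; apply: rec_ext (rec_iteri ra (rec_const 0)
  (rec_app2 rec2_sub (rec_const 1) (rec_var 1))) => e.
by elim: (a e) => //= n ->; case: odd.
Qed.

Lemma rec_letter_inv a : rec a -> rec (fun e => letter_inv (a e)).
Proof. by move=> ra; apply: rec_if (rec_odd ra) (rec_app1 rec1_pred ra) (rec_succ ra). Qed.

Lemma recl_red l : recl l -> recl (fun e => red (l e)).
Proof.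
move=> rl; apply: (recl_foldr (h := fun a r _ => push a r)) recl_nil rl (rec_const 0).
have rs := recl_decode (rec_var 1).
have rp : recb (fun e => (0 < size (CodeSeq.decode (nth 0 e 1))) &&
    (head 0 (CodeSeq.decode (nth 0 e 1)) == letter_inv (nth 0 e 0))).
  apply: recb_and; first exact: recb_ltn (rec_const 0) (rec_size rs).
  exact: recb_eq (rec_head rs) (rec_letter_inv (rec_var 0)).
apply: rec_ext (rec_if rp (recl_behead rs) (recl_cons (rec_var 0) rs)) => e /=.
by case: (CodeSeq.decode (nth 0 e 1)) => //= b r; case: ifP.
Qed.

Lemma size_flatten_map_leq k (f : 'I_k -> seq nat) u :
  size (flatten (map f u)) <= (\max_i size (f i)) * size u.
Proof.
rewrite -[X in _ * X](size_map f); apply: size_flatten_leq => _ /mapP[i _ ->].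
exact: leq_bigmax.
Qed.

Lemma size_expand k (fw : 'I_k -> seq nat) u :
  size (expand fw u) = size (flatten (map fw u)) + size u.
Proof.
elim: u => //= i u IH; rewrite /expand /= !size_cat -/(expand fw u) IH size_rcons size_map.
by rewrite addSn addnS addnA.
Qed.

(** Equality is tested in each factor. For the length bound, the free factor supplies the Dyck
    condition, with the inverse of the spelling of [w] in front, and [M] the states and vectors. *)
Theorem product_decider (F : groupType) (M : monoidType) k (s : 'I_k -> (F * M)%type)
    (wpM : seq nat -> seq nat -> bool) :
  free_group F ->
  recb (fun e => wpM (CodeSeq.decode (nth 0 e 0)) (CodeSeq.decode (nth 0 e 1))) ->
  (forall u w : seq 'I_k, wpM (map val u) (map val w) <->
    word_value (fun i => (s i).2) u = word_value (fun i => (s i).2) w) ->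
  vector_acceptable (fun i => (s i).2) ->
  exists2 f, recursive f & rational_subset_decider s f.
Proof.
move=> Ffree rwp wpE [d [k0 acc]].
have [fw fwE] := free_group_words (fun i => (s i).1) Ffree.
pose W (w : seq nat) := red (flatten (map (extend_ord fw) w)).
pose mx := \max_i size (fw i).
(* One quantity dominating the number of edges, the lengths of all tracks, the states, the loops and
   the vector entries; a track of a label has at most [mx + 1] atoms per generator. *)
pose C a w := (k0 + mx + 2) * (a + w + 2).
apply: (@decidable_of_path_bound _ _ _ (fun u w => (W u == W w) && wpM u w)
  (fun a w => path_bound (C a w ^ 7) d (C a w))).
- apply: recb_and rwp; apply: recb_eql; apply: recl_red;
    apply: (recl_flatten_map (extend_ord_support fw)); apply: recl_decode; exact: rec_var.
- move=> u w; rewrite !word_value_pair /W !flatten_extend_ord; split.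
    by case/andP => /eqP/fwE-> /wpE->.
  by case=> /fwE-> /wpE->; rewrite eqxx.
- have rC : rec (fun e => C (nth 0 e 0) (nth 0 e 1)).
    exact: rec_app2 rec2_mul (rec_const (k0 + mx + 2))
      (rec_app2 rec2_add (rec_app2 rec2_add (rec_var 0) (rec_var 1)) (rec_const 2)).
  exact: rec_path_bound (rec_app2 rec2_exp rC (rec_const 7)) (rec_const d) rC.
move=> A ns q w pq; rewrite !word_value_pair => -[/fwE Ef Em].
have [z0 [zb [next [vec [nl [lvec [kappa [ls /=
  [[/andP[z0b zbc] nlc] nextb [vb lb kb] [lsn wE] back]]]]]]]]] := acc _ _ Em.
set c := C _ _; have ww : size w <= word_code w.
  by rewrite -(size_map val); apply: size_leq_code.
have cc : k0 * (size w + 1) <= c by rewrite /c /C leq_mul //; lia.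
have trc t : t <= size (edges A) ->
    size (track fw A (word_inv (flatten (map fw w))) t) < c.
  move=> _; case: t => [|t] /=.
    rewrite size_map size_rev size_map; apply: leq_ltn_trans (size_flatten_map_leq _ _) _.
    rewrite -/mx /c /C; apply: leq_ltn_trans (leq_mul (leqnn mx) ww) _; nia.
  rewrite size_expand; have := size_flatten_map_leq fw (edge A t).1.2.
  have := label_leq_code A t; rewrite -/mx /c /C; nia.
have [|||||||ns' [ls' [[pq' sns'] dy' run' als' wE']]] :=
  @short_apath k fw A (word_inv (flatten (map fw w))) z0 zb next vec nl lvec z0b nextb
    c d kappa ns ls q _ trc _ _ _ _ _ pq _ lsn wE.
- by apply: leq_trans (edges_leq_code A) _; rewrite /c /C; nia.
- exact: leq_trans cc.
- exact: leq_trans cc.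
- by move=> g i id; apply: bounded_leq (vb g i id).
- by move=> l i lnl id; apply: bounded_leq (lb l i lnl id).
- by move=> i id; apply: bounded_leq (kb i id).
- exact/dyck_quotient.
exists ns'; split=> //; rewrite !word_value_pair.
by move/dyck_quotient/fwE: dy' => ->; rewrite (back _ _ run' als' wE').
Qed.

(** * Commutative monoids *)

Section Commutative.
Variables (M : monoidType) (k : nat) (m : 'I_k -> M).
Hypothesis mulC : forall x y : M, (x * y = y * x)%g.
Local Notation V := {ffun bool * 'I_k -> nat}.

(** A pair of words is one vector, with the exponents of the first word at [true] and of the second
    at [false], so that the congruence of [M] becomes a set of vectors. *)
Definition half_value b (v : V) : M := (\prod_(i <- enum 'I_k) m i ^+ v (b, i))%g.

Lemma half_value_add b x y : half_value b (vadd x y) = (half_value b x * half_value b y)%g.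
Proof.
rewrite /half_value; elim: (enum 'I_k) => [|i l IH]; first by rewrite !big_nil mul1g.
rewrite !big_cons IH ffunE expgnDr !mulgA; congr (_ * _)%g.
by rewrite -!mulgA; congr (_ * _)%g; apply: mulC.
Qed.

Definition same_value (v : V) := half_value true v = half_value false v.

Lemma slice_same_value : slice same_value.
Proof.
move=> x y z; rewrite /same_value !half_value_add.
set a := half_value true x; set b := half_value false x.
set c := half_value true y; set d := half_value false y.
set e := half_value true z; set f := half_value false z.
(* As [a = b], one has [a c e = b d e = b e d = a e d = b f d]. *)
move=> ab acbd aebf; rewrite acbd -!mulgA (mulC d e) (mulC d f) !mulgA.
by rewrite -{1}ab aebf.
Qed.

Definition counts (u w : seq nat) : V :=
  [ffun bi => count_mem (val bi.2) (if bi.1 then u else w)].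

Lemma word_value_counts (b : bool) u (v : V) :
  (forall i, v (b, i) = count_mem i u) -> word_value m u = half_value b v.
Proof.
move=> vE; rewrite /half_value (eq_bigr (fun i => m i ^+ count_mem i u)%g); last first.
  by move=> i _; rewrite vE.
elim: u {v vE} => [|j u IH].
  by rewrite /word_value big_nil big1.
rewrite /word_value big_cons -/(word_value m u) IH.
have : j \in enum 'I_k by rewrite mem_enum.
have := enum_uniq 'I_k; elim: (enum 'I_k) => //= i l IHl /andP[il ul].
rewrite inE => /orP[/eqP ji|jl]; rewrite !big_cons.
  subst i; rewrite eqxx expgnDr expg1 mulgA; congr (_ * _)%g.
  apply: eq_big_seq => i il' /=; case: (j =P i) => [ji|_]; last by rewrite add0n.
  by rewrite ji il' in il.
rewrite -IHl // mulgA (mulC (m j) (m i ^+ _)%g) -mulgA; congr (_ * _)%g.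
rewrite /=; case: (j =P i) => [ji|_]; last by rewrite add0n.
by rewrite -ji jl in il.
Qed.

Lemma same_value_counts (u w : seq 'I_k) :
  same_value (counts (map val u) (map val w)) <-> word_value m u = word_value m w.
Proof.
rewrite (@word_value_counts true u (counts (map val u) (map val w))).
  rewrite (@word_value_counts false w (counts (map val u) (map val w))) //.
  by move=> i; rewrite ffunE /= count_map; apply: eq_count => j; rewrite /= val_eqE.
by move=> i; rewrite ffunE /= count_map; apply: eq_count => j; rewrite /= val_eqE.
Qed.

End Commutative.

(** * Deciding membership in linear sets *)

Section LinearSetTest.
Variable I : finType.
Local Notation V := {ffun I -> nat}.

Definition vscale n (p : V) : V := [ffun i => n * p i].

(** A nonzero period is used at most [weight v] times, so finitely many multiplicities are tried. *)
Fixpoint in_linear_set (b : V) (ps : seq V) (v : V) : bool :=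
  if ps is p :: ps' then
    has (fun n => vle (vscale n p) v && in_linear_set b ps' (vsub v (vscale n p)))
      (iota 0 (weight v).+1)
  else v == b.

Lemma vscale0 p : vscale 0 p = vzero I.
Proof. by apply/ffunP => i; rewrite !ffunE. Qed.

Lemma vscaleS n p : vscale n.+1 p = vadd p (vscale n p).
Proof. by apply/ffunP => i; rewrite !ffunE mulSn. Qed.

Lemma vadd0l (v : V) : vadd (vzero I) v = v.
Proof. by rewrite vaddC vadd0. Qed.

Lemma vsum_split b p (s : seq V) :
  vsum b s = vadd (vscale (count_mem p s) p) (vsum b [seq x <- s | x != p]).
Proof.
elim: s => [|x s IH] /=; first by rewrite vscale0 vadd0l.
rewrite -/(vsum b s) IH; case: eqP => [->|_] /=; first by rewrite add1n vscaleS vaddA.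
by rewrite add0n vaddCA.
Qed.

Lemma weight_scale n p : weight (vscale n p) = n * weight p.
Proof. by rewrite /weight big_distrr; apply: eq_bigr => i _; rewrite ffunE. Qed.

Lemma in_linear_set_cons b p ps v : in_linear_set b (p :: ps) v =
  has (fun n => vle (vscale n p) v && in_linear_set b ps (vsub v (vscale n p)))
    (iota 0 (weight v).+1).
Proof. by []. Qed.

Lemma in_linear_setP b ps v : in_linear_set b ps v <-> linear_set b ps v.
Proof.
elim: ps v => [|p ps IH] v; last rewrite in_linear_set_cons.
  split=> [/eqP->|[[|x s] sub ->]]; first by exists [::].
    exact: eqxx.
  by have := sub x (mem_head _ _).
split=> [/hasP[n _ /andP[le /IH[s sub E]]]|[s sub E]].
  exists (nseq n p ++ s).
    move=> x; rewrite mem_cat mem_nseq inE => /orP[/andP[_ ->] //|/sub ->].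
    exact: orbT.
  rewrite -(vsubK le) E; elim: (n) => [|n' IHn]; first by rewrite vscale0 vadd0l.
  by rewrite vscaleS -vaddA IHn.
(* The count of a zero period is not bounded by the weight, so its multiplicity is set to 0. *)
pose n := if p == vzero I then 0 else count_mem p s.
have En : vscale n p = vscale (count_mem p s) p.
  by rewrite /n; case: eqP => // ->; apply/ffunP => i; rewrite !ffunE !muln0.
have Ev : v = vadd (vscale n p) (vsum b [seq x <- s | x != p]).
  by rewrite En E; apply: vsum_split.
have le : vle (vscale n p) v by rewrite [X in vle _ X]Ev vle_add.
apply/hasP; exists n; last first.
  rewrite le; apply/IH; exists [seq x <- s | x != p].
    move=> x; rewrite mem_filter => /andP[xp /sub].
    by rewrite inE (negbTE xp).
  apply/ffunP => i; have /ffunP/(_ i) := Ev; rewrite !ffunE => ->.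
  by rewrite addKn.
rewrite mem_iota /= ltnS; have /(congr1 (@weight I)) := Ev.
rewrite weight_add weight_scale => ->; apply: leq_trans (leq_addr _ _).
rewrite /n; case: eqP => // p0; rewrite leq_pmulr // lt0n.
by apply/eqP => /weight_eq0.
Qed.

Lemma recb_all (T : Type) (l : seq T) (p : T -> seq nat -> bool) :
  (forall t, recb (p t)) -> recb (fun e => all (fun t => p t e) l).
Proof.
move=> rp; elim: l => [|t l IH] /=; first exact: rec_const.
exact: recb_and.
Qed.

Lemma recb_has_seq (T : Type) (l : seq T) (p : T -> seq nat -> bool) :
  (forall t, recb (p t)) -> recb (fun e => has (fun t => p t e) l).
Proof.
move=> rp; elim: l => [|t l IH] /=; first exact: rec_const.
exact: recb_or.
Qed.

Lemma rec_weight (v : seq nat -> V) :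
  (forall i, rec (fun e => v e i)) -> rec (fun e => weight (v e)).
Proof.
move=> rv; rewrite /weight /index_enum; elim: (locked_with _ _) => [|i l IH].
  by apply: rec_ext (rec_const 0) => e; rewrite big_nil.
by apply: rec_ext (rec_app2 rec2_add (rv i) IH) => e; rewrite big_cons.
Qed.

Lemma rec_behead f : rec f -> rec (fun e => f (behead e)).
Proof.
move=> rf; apply: rec_env rf _ => i.
by apply: rec_ext (rec_var i.+1) => e; rewrite nth_behead.
Qed.

Lemma recb_in_linear_set b ps (v : seq nat -> V) :
  (forall i, rec (fun e => v e i)) -> recb (fun e => in_linear_set b ps (v e)).
Proof.
elim: ps v => [|p ps IH] v rv /=.
  apply: recb_ext (recb_all (enum I) (p := fun i e => v e i == b i) _) => [e|i].
    apply/allP/eqP => [H|-> //]; apply/ffunP => i; apply/eqP/H.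
    by rewrite mem_enum.
  exact: recb_eq (rv i) (rec_const _).
have rs i : rec (fun e => nth 0 e 0 * p i) by apply: rec_app2 rec2_mul (rec_var 0) (rec_const _).
apply: (@recb_has (fun e => (weight (v e)).+1) (fun e =>
  vle (vscale (nth 0 e 0) p) (v (behead e)) &&
  in_linear_set b ps (vsub (v (behead e)) (vscale (nth 0 e 0) p)))).
  exact: rec_succ (rec_weight rv).
apply: recb_and.
  apply: recb_ext (recb_all (enum I) (p := fun i e => nth 0 e 0 * p i <= v (behead e) i) _).
    move=> e; apply/allP/forallP => H i; last by move=> _; have := H i; rewrite ffunE.
    by rewrite ffunE; apply: H; rewrite mem_enum.
  by move=> i; apply: recb_leq (rs i) (rec_behead (rv i)).
apply: IH => i; apply: rec_ext (rec_app2 rec2_sub (rec_behead (rv i)) (rs i)) => e.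
by rewrite !ffunE.
Qed.

End LinearSetTest.

Section CommutativeAcceptor.
Variables (M : monoidType) (k : nat) (m : 'I_k -> M).
Hypothesis mulC : forall x y : M, (x * y = y * x)%g.
Local Notation I := (bool * 'I_k)%type.
Local Notation V := {ffun I -> nat}.

(** The list [L] of linear sets is not computed, but it depends on the generators alone and so
    enters the algorithm as a constant. *)
Lemma commutative_word_problem : exists wp : seq nat -> seq nat -> bool,
  recb (fun e => wp (CodeSeq.decode (nth 0 e 0)) (CodeSeq.decode (nth 0 e 1))) /\
  forall u w : seq 'I_k, wp (map val u) (map val w) <-> word_value m u = word_value m w.
Proof.
have [L HL] := slice_semilinear (slice_same_value (m := m) mulC).
exists (fun u w => has (fun bp => in_linear_set bp.1 bp.2 (counts k u w)) L); split.
  apply: recb_has_seq => bp; apply: recb_in_linear_set => -[b i].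
  (* As a number, [~~ b] is a position in the environment: [u] stands at 0 and belongs to [true],
     [w] at 1 and belongs to [false]. *)
  apply: rec_ext (rec_count (rec_const (val i)) (recl_decode (rec_var (~~ b)))) => e.
  by rewrite ffunE /=; case: b.
move=> u w; rewrite -(same_value_counts m mulC) HL; split.
  by case/hasP => bp bpL /in_linear_setP H; exists bp.
by case=> bp bpL H; apply/hasP; exists bp => //; apply/in_linear_setP.
Qed.

Definition coord (v : V) i := nth 0 [seq v j | j <- enum {: I}] i.

Lemma coord_add x y i : coord (vadd x y) i = coord x i + coord y i.
Proof.
rewrite /coord; elim: (enum _) i => [|j l IH] [|i] //=; first by rewrite ffunE.
Qed.

Lemma coord_inj x y : (forall i, i < #|{: I}| -> coord x i = coord y i) -> x = y.
Proof.
move=> E; apply/ffunP => j.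
have jI : j \in enum {: I} by rewrite mem_enum.
have nj : nth j (enum {: I}) (index j (enum {: I})) = j by apply: nth_index.
have ij : index j (enum {: I}) < size (enum {: I}) by rewrite index_mem.
have := E (index j (enum {: I})); rewrite cardE ij => /(_ isT).
by rewrite /coord !(nth_map j _ _ ij) nj.
Qed.

Lemma coord_leq_weight v i : coord v i <= weight v.
Proof.
rewrite /coord; have [iI|iI] := ltnP i (size (enum {: I})); last first.
  by rewrite nth_default ?leq0n // size_map.
have [j0 _] : exists j0 : I, true by case: (enum {: I}) iI => // j0; exists j0.
by rewrite (nth_map j0) // /weight (bigD1 (nth j0 (enum {: I}) i)) //= leq_addr.
Qed.

Definition letter_vector (g : 'I_k) : V := [ffun bi => (bi == (true, g)) : nat].

Lemma counts_split (u w : seq 'I_k) :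
  counts k (map val u) (map val w) =
  vsum (counts k [::] (map val w)) [seq letter_vector g | g <- u].
Proof.
elim: u => [|g u /= <-]; first by [].
apply/ffunP => -[[] i]; rewrite !ffunE //=.
by rewrite xpair_eqE /= val_eqE eq_sym.
Qed.

Lemma coord_vsum b s i : coord (vsum b s) i = coord b i + \sum_(p <- s) coord p i.
Proof.
elim: s => [|p s IH] /=; first by rewrite big_nil addn0.
by rewrite coord_add -/(vsum b s) IH big_cons addnCA.
Qed.

Lemma sum_Posz (T : Type) (f : T -> nat) s :
  (\sum_(x <- s) (f x)%:Z = (\sum_(x <- s) f x)%N%:Z)%R.
Proof. by elim: s => [|x s IH]; rewrite ?big_nil // !big_cons IH. Qed.

(** The vector of [u] and [w] lies in one linear set, with base [b] and periods [ps]. Generators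
    count positively, a loop subtracts a period, and the target is [b] minus the contribution of
    [w]; a single state suffices. *)
Lemma commutative_vector_acceptable : vector_acceptable m.
Proof.
have [L HL] := slice_semilinear (slice_same_value (m := m) mulC).
(* The maximum is over all linear sets, since the constant must be chosen before [u] and [w]. *)
pose K := \max_(bp <- L) (weight bp.1 + size bp.2 + \sum_(p <- bp.2) weight p).
exists #|{: I}|, (K + 2) => u w /(same_value_counts m mulC)/HL[[b ps] bpL [z zps Ez]].
have Kb : weight b + size ps + \sum_(p <- ps) weight p <= K by apply: (leq_bigmax_seq (b, ps)).
pose wv : V := counts k [::] (map val w).
pose vec g i := Posz (coord (letter_vector g) i).
pose lvec l i := (- Posz (coord (nth (vzero _) ps l) i))%R.
pose kappa i := (Posz (coord b i) - Posz (coord wv i))%R.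
have key u' ls : (forall i, i < #|{: I}| ->
    (gens_weight vec u' i + loops_weight lvec ls i = kappa i)%R) <->
    counts k (map val u') (map val w) = vsum b [seq nth (vzero _) ps l | l <- ls].
  rewrite counts_split -/wv /gens_weight /loops_weight.
  have E i : (\sum_(g <- u') vec g i + \sum_(l <- ls) lvec l i = kappa i)%R <->
      coord (vsum wv [seq letter_vector g | g <- u']) i =
      coord (vsum b [seq nth (vzero _) ps l | l <- ls]) i.
    rewrite !coord_vsum !big_map /vec /lvec sumrN !sum_Posz /kappa.
    by move: (\sum_(j <- u') _) (\sum_(j <- ls) _) => x y; split; lia.
  split=> [H|H i _]; last by apply/E; rewrite H.
  by apply: coord_inj => i iI; apply/E/H.
exists 0, 1, (fun _ _ => 0), vec, (size ps), lvec, kappa, [seq index x ps | x <- z] => /=.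
set c := (K + 2) * (size w + 1).
have Kc : K + size w < c by rewrite /c; nia.
have bK : weight b <= K by apply: leq_trans Kb; rewrite -addnA leq_addr.
have psK : size ps <= K by apply: leq_trans Kb; rewrite addnAC leq_addl.
have sK : \sum_(p <- ps) weight p <= K by apply: leq_trans Kb; apply: leq_addl.
have cb i : coord b i <= K by apply: leq_trans (coord_leq_weight b i) bK.
clearbody c K.
split.
- by rewrite (leq_ltn_trans (leq0n _) Kc) (leq_ltn_trans psK) // (leq_ltn_trans _ Kc) ?leq_addr.
- by [].
- split=> [g i _|l i lps _|i _].
  + rewrite /vec /bounded; have : coord (letter_vector g) i <= 1; last by lia.
    by rewrite /coord; elim: (enum _) i => [|j s IH] [|i] //=; rewrite ffunE; case: (_ == _).
  + rewrite /lvec /bounded; have := coord_leq_weight (nth (vzero _) ps l) i.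
    have : weight (nth (vzero _) ps l) <= K; last by lia.
    apply: leq_trans sK; rewrite (big_nth (vzero _)) big_mkord (bigD1 (Ordinal lps)) //=.
    exact: leq_addr.
  + rewrite /kappa /bounded; have := cb i.
    have : coord wv i <= size w; last by lia.
    rewrite /coord; elim: (enum _) i => [|[b' j] s IH] [|i] //=; rewrite ffunE /=.
    by case: b'; rewrite // -(size_map val w) count_size.
- split; first by apply/allP => _ /mapP[x /zps xps ->]; rewrite /= index_mem.
  apply/key; rewrite Ez -map_comp /=; congr vsum; rewrite -[LHS]map_id.
  by apply/eq_in_map => x /zps xps; rewrite /= nth_index.
- move=> u' ls' _ als /key E; apply/(same_value_counts m mulC)/HL.
  exists (b, ps) => //=; exists [seq nth (vzero _) ps l | l <- ls'] => // x.
  by case/mapP => l /(allP als) lps ->; apply: mem_nth.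
Qed.

End CommutativeAcceptor.

(** * Free monoids *)

Section FreeMonoid.
Variables (X : finType) (k : nat) (m : 'I_k -> free_monoid X).

Lemma word_value_free u : word_value m u = flatten (map m u) :> seq X.
Proof.
elim: u => [|i u IH]; first by rewrite /word_value big_nil.
by rewrite /word_value big_cons -/(word_value m u) /= -IH.
Qed.

Lemma free_monoid_word_problem : exists wp : seq nat -> seq nat -> bool,
  recb (fun e => wp (CodeSeq.decode (nth 0 e 0)) (CodeSeq.decode (nth 0 e 1))) /\
  forall u w : seq 'I_k, wp (map val u) (map val w) <-> word_value m u = word_value m w.
Proof.
pose f i := [seq val (enum_rank x) | x <- (m i : seq X)].
pose W u := flatten (map (extend_ord f) u).
have WE u : W (map val u) = [seq val (enum_rank x) | x <- (word_value m u : seq X)].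
  rewrite word_value_free map_flatten -map_comp /W -map_comp.
  by congr flatten; apply: eq_map => i; apply: extend_ord_val.
exists (fun u w => W u == W w); split.
  by apply: recb_eql; apply: (recl_flatten_map (extend_ord_support f));
    apply: recl_decode; apply: rec_var.
move=> u w; rewrite !WE; split=> [/eqP E|->]; last exact: eqxx.
by apply: (inj_map _ E) => x y /val_inj/enum_rank_inj.
Qed.

(** The state is the number of letters of [W] read so far; [(size W).+1] is a sink reached on a
    mismatch. *)
Definition read_next (W : seq X) z i :=
  if (z <= size W) && prefix (m i : seq X) (drop z W) then z + size (m i : seq X)
  else (size W).+1.

Lemma run_read_next W u z : z <= size W ->
  (run (read_next W) z u == size W) = (flatten (map m u) == drop z W).
Proof.
have sink u' : run (read_next W) (size W).+1 u' = (size W).+1.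
  have stop i : read_next W (size W).+1 i = (size W).+1 by rewrite /read_next ltnn.
  by elim: u' => //= i u' IH; rewrite stop.
elim: u z => [|i u IH] z zW /=.
  by rewrite [RHS]eq_sym -size_eq0 size_drop subn_eq0 eqn_leq zW.
rewrite {2}/read_next zW /=; case: prefixP => [[t Et]|np].
  have zi : z + size (m i : seq X) <= size W.
    rewrite -[leqRHS](subnKC zW) leq_add2l.
    by have := congr1 size Et; rewrite size_drop size_cat => ->; apply: leq_addr.
  rewrite IH // Et -[drop (z + _) W]/(drop _ W) addnC -drop_drop Et drop_size_cat //.
  by rewrite eqseq_cat ?eqxx.
rewrite sink eqn_leq ltnn /=; apply/esym/negbTE/eqP => E; case: np.
by exists (flatten (map m u)).
Qed.

Lemma free_monoid_vector_acceptable : vector_acceptable m.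
Proof.
pose mx := \max_i size (m i : seq X).
(* In dimension 0 the final state alone decides; the second constant leaves room for the
   [(size W).+2] states. *)
exists 0, (mx + 2) => u w Euw.
pose W : seq X := word_value m w.
have sW : size W <= mx * size w.
  rewrite /W word_value_free -[X in _ * X](size_map (m : 'I_k -> seq X)).
  by apply: size_flatten_leq => _ /mapP[i _ ->]; apply: (leq_bigmax i).
have runP v : run (read_next W) 0 v = size W <-> word_value m v = word_value m w.
  have := run_read_next v (leq0n (size W)); rewrite drop0 -word_value_free => E.
  by split=> /eqP; rewrite ?E => H; apply/eqP; rewrite ?E.
exists 0, (size W).+2, (read_next W), (fun _ _ => 0%R), 0, (fun _ _ => 0%R), (fun=> 0%R), [::].
set c := (mx + 2) * (size w + 1).
have Wc : (size W).+2 <= c by rewrite /c; clearbody W c mx; nia.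
split=> //.
- by split=> //; apply: leq_trans Wc.
- move=> z i _; rewrite /read_next; case: ifP => // /andP[zW /prefixP[t Et]].
  rewrite ltnS; apply: leqW; rewrite -[leqRHS](subnKC zW) leq_add2l.
  by have := congr1 size Et; rewrite size_drop size_cat => ->; apply: leq_addr.
- by move=> u' ls'; rewrite (iffRL (runP u) Euw) => /runP.
Qed.

End FreeMonoid.

(** * Finite generation of the products *)

Section FiniteGeneration.

Lemma word_value_cat (N : monoidType) k (s : 'I_k -> N) u v :
  word_value s (u ++ v) = (word_value s u * word_value s v)%g.
Proof. exact: big_cat. Qed.

Lemma finitely_generated_group_monoid (G : groupType) :
  finitely_generated_group G -> finitely_generated_monoid G.
Proof.
case=> k [s Hs].
exists (k + k), (fun i => match split i with inl j => s j | inr j => ((s j)^-1)%g end) => x.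
have [w ->] := Hs x.
exists [seq (if a.2 then rshift k a.1 else lshift k a.1) | a <- w].
rewrite /word_value big_map; apply: eq_bigr => -[i [|]] _ /=.
  by rewrite (unsplitK (inr i)).
by rewrite (unsplitK (inl i)).
Qed.

Lemma finitely_generated_pair (N M : monoidType) :
  finitely_generated_monoid N -> finitely_generated_monoid M ->
  finitely_generated_monoid (N * M)%type.
Proof.
case=> k [s Hs] [l [t Ht]].
exists (k + l), (fun i => match split i with inl j => (s j, 1%g) | inr j => (1%g, t j) end).
case=> x y; have [u ->] := Hs x; have [v ->] := Ht y.
exists (map (lshift l) u ++ map (@rshift k l) v); rewrite word_value_cat.
set f := fun i => _.
have -> : word_value f (map (lshift l) u) = (word_value s u, 1%g).
  elim: u => [|i u IH]; first by rewrite /word_value !big_nil.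
  rewrite /word_value /= !big_cons -!/(word_value _ _) IH /f (unsplitK (inl i)).
  by congr (_, _); rewrite /= mul1g.
have -> : word_value f (map (@rshift k l) v) = (1%g, word_value t v).
  elim: v => [|i v IH]; first by rewrite /word_value !big_nil.
  rewrite /word_value /= !big_cons -!/(word_value _ _) IH /f (unsplitK (inr i)).
  by congr (_, _); rewrite /= mul1g.
by congr (_, _); rewrite /= ?mulg1 ?mul1g.
Qed.

Lemma finitely_generated_free_monoid (X : finType) :
  finitely_generated_monoid (free_monoid X).
Proof.
exists #|X|, (fun i => [:: enum_val i]) => x; exists (map enum_rank (x : seq X)).
rewrite word_value_free; elim: (x : seq X) => //= a l {1}->.
by rewrite enum_rankK.
Qed.

End FiniteGeneration.

Theorem theorem6p5 (F : groupType)
    (F_free : free_group F) (F_fg : finitely_generated_group F) :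
  [/\ forall A : groupType,
        (forall x y : A, (x * y = y * x)%g) -> finitely_generated_group A ->
        rational_subset_problem_decidable (F * A)%type,
      forall M : monoidType,
        (forall x y : M, (x * y = y * x)%g) -> finitely_generated_monoid M ->
        rational_subset_problem_decidable (F * M)%type
    & forall X : finType,
        rational_subset_problem_decidable (F * free_monoid X)%type].
Proof.
have F_fgm := finitely_generated_group_monoid F_fg.
have commutative_case (M : monoidType) : (forall x y : M, (x * y = y * x)%g) ->
    finitely_generated_monoid M -> rational_subset_problem_decidable (F * M)%type.
  move=> mulC M_fg; split=> [|k s _]; first exact: finitely_generated_pair.
  have [wp [rwp wpE]] := commutative_word_problem (fun i => (s i).2) mulC.
  exact: product_decider rwp wpE (commutative_vector_acceptable _ mulC).
split=> [A mulC A_fg|//|X].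
  (* Adding the inverses of the generators makes [A] a finitely generated monoid, so the first case
     is an instance of the second. *)
  exact: (commutative_case A mulC (finitely_generated_group_monoid A_fg)).
split=> [|k s _]; first exact: finitely_generated_pair (finitely_generated_free_monoid X).
have [wp [rwp wpE]] := free_monoid_word_problem (fun i => (s i).2).
exact: product_decider rwp wpE (free_monoid_vector_acceptable _).
Qed.
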